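(* Let $r\ge1$ and let $T$ be a cell of dimension $d$. For elements $u$ of the (high order) space $A^k(T)$, the moments $\int_T u\wedge w$ against $w\in \mathrm{P}^r\Lambda^{d-k}(T)$ can be computed inductively from the degrees of freedom of $u$, i.e. from the integrals $\int_{T'}u\wedge e$, where $T'$ ranges over the faces of $T$ (including $T$) and $e\in \mathrm{P}^r_-\Lambda^{\dim T'-k}(T')$.
   Context: $T$ denotes a polytope (a flat cell of a polytopal mesh) of dimension $d$, oriented and equipped with the Euclidean metric. Its faces $T'$ include $T$ itself; each face is also a cell, and is oriented. Differential forms are real valued; the trace $u|_{T'}$ of a form $u$ on a face $T'$ is its pullback by the inclusion $T' \to T$ (integrals of $u$ on $T'$ involve this trace). $X^k(T)$ is the space of $k$-forms $u$ in $L^2(T)$ with $\mathrm{d}u$ in $L^2(T)$, and $X^k_0(T)=\{u\in X^k(T): u|_{\partial T}=0\}$ (so $X^d_0(T)=X^d(T)$). The pointwise scalar product of forms is $u\cdot v$; orthogonality $\perp$ is with respect to the $L^2$ scalar product; $\mathrm{d}^\star$ is the formal $L^2$-adjoint of $\mathrm{d}$. $\mathrm{P}^s\Lambda^k(T)$ is the space of polynomial $k$-forms of degree at most $s$. With $b_T$ the barycentre of $T$, $\kappa_T$ denotes contraction of forms by the vector field $x\mapsto x-b_T$, and $\mathrm{P}^s_-\Lambda^k(T)=\{u\in \mathrm{P}^s\Lambda^k(T): \kappa_T u\in \mathrm{P}^s\Lambda^{k-1}(T)\}$. Spaces of $k$-forms with $k<0$ or $k>d$ are zero. Fix $r\ge1$.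 For $d\geq 1$ set $$U^k(T)=\{u\in \mathrm{P}^{r+1}_-\Lambda^k(T): u\perp \mathrm{P}^r\Lambda^k(T)\},\qquad W^k(T)=\mathrm{d}U^{k-1}(T)+U^k(T),$$ $$Z^k_0(T)=\{u\in X^k_0(T): \forall w\in W^{d-k}(T)\ \int_T u\wedge w=0\},\qquad Y^k(T)=\{u\in Z^k_0(T): u\perp \mathrm{d}Z^{k-1}_0(T)\},$$ $$G^k(T)=\{(f,g)\in \mathrm{P}^{r-1}\Lambda^k(T)\times \mathrm{P}^{r-1}\Lambda^{k-1}(T): \mathrm{d}^\star f=0,\ \mathrm{d}^\star g=0\}.$$ $B^k(T)$ is the space of $u\in X^k(T)$ for which there exist $(f,g)\in G^k(T)$, $a\in U^{d-k-1}(T)$, $b\in U^{d-k}(T)$ and $v\in Y^{k-1}(T)$ such that $$\int_T \mathrm{d}u\cdot \mathrm{d}u'+\int_T \mathrm{d}u'\wedge a+\int_T u'\wedge b+\int_T u'\cdot \mathrm{d}v=\int_T f\cdot u',$$ $$\int_T \mathrm{d}u\wedge a'=0,\quad \int_T u\wedge b'=0,\quad \int_T u\cdot \mathrm{d}v'=\int_T g\cdot v',$$ for all $u'\in X^k_0(T)$, $a'\in U^{d-k-1}(T)$, $b'\in U^{d-k}(T)$, $v'\in Y^{k-1}(T)$. For $T$ a point, $B^0(T)=\mathbb{R}$. $A^k(T)=\{u\in X^k(T): u|_{T'}\in B^k(T') \text{ for every face } T' \text{ of } T \text{ (including } T'=T)\}$. ''Computed inductively from the degrees of freedom'' means: by an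 explicit procedure, inductive on the dimension of the faces of $T$, which expresses each moment as a linear combination of the degrees of freedom of $u$, with coefficients obtained from finitely many operations on polynomial forms on the faces of $T$ (algebra, exterior derivative, Koszul operators $\kappa_{T'}$, restriction to faces, $L^2$ projections onto spaces of polynomial forms, integration of polynomials), without solving the PDEs defining $B^k$. *)

(* Defs.v *)
From HB Require Import structures.
From mathcomp Require Import all_boot all_order all_algebra.
From mathcomp Require Import all_classical all_reals all_analysis.
From mathcomp Require mpoly.
Set Implicit Arguments.
Unset Strict Implicit.
Unset Printing Implicit Defensive.
Import Order.TTheory GRing.Theory Num.Theory.
Import numFieldNormedType.Exports.
Local Open Scope classical_set_scope.
Local Open Scope ring_scope.

Section ConsMeasure.
Context {d : measure_display} {T : measurableType d} {R : realType}.
Variables (n : nat) (m1 : {sigma_finite_measure set T -> \bar R})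
  (m2 : {sigma_finite_measure set (n.-tuple T) -> \bar R}).

Definition cons_pair (z : T * n.-tuple T) : n.+1.-tuple T :=
  [the n.+1.-tuple T of z.1 :: z.2].

Lemma measurable_cons_pair : measurable_fun setT cons_pair.
Proof. by apply: measurable_cons. Qed.

Definition cons_measure : set (n.+1.-tuple T) -> \bar R :=
  pushforward (m1 \x m2)%E cons_pair.

Let cons_measure0 : cons_measure set0 = 0%E.
Proof. by rewrite /cons_measure /pushforward preimage_set0 measure0. Qed.

Let cons_measure_ge0 A : (0 <= cons_measure A)%E.
Proof. by rewrite /cons_measure /pushforward; apply: integral_ge0. Qed.

Let cons_measure_sigma_additive : semi_sigma_additive cons_measure.
Proof.
exact: (@measure_semi_sigma_additive _ _ _
  (measure_function_pushforward__canonical__measure_function_Measure (m1 \x m2)%E measurable_cons_pair)).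
Qed.

HB.instance Definition _ := isMeasure.Build _ _ _ cons_measure
  cons_measure0 cons_measure_ge0 cons_measure_sigma_additive.

Let cons_measure_sigma_finite : sigma_finite setT cons_measure.
Proof.
have /sigma_finiteP[F [TF ndF Foo]] := sigma_finiteT m1.
have /sigma_finiteP[G [TG ndG Goo]] := sigma_finiteT m2.
pose g (t : n.+1.-tuple T) := (thead t, [tuple of behead t]).
have mg : measurable_fun setT g.
  by apply/measurable_fun_pairP; split;
    [exact: measurable_tnth | exact: measurable_behead].
have gK : g \o cons_pair = id.
  by apply/funext => -[x t]; rewrite /g /=; congr pair; exact: val_inj.
exists (fun i => g @^-1` (F i `*` G i)).
  rewrite -preimage_bigcup (_ : \bigcup_i _ = setT) ?preimage_setT//.
  rewrite predeqE => -[x y]; split=> // _.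
  have [i _ Fix] : (\bigcup_i F i) x by rewrite -TF.
  have [j _ Gjy] : (\bigcup_j G j) y by rewrite -TG.
  exists (maxn i j) => //; split.
  - by move: x Fix; exact/subsetPset/ndF/leq_maxl.
  - by move: y Gjy; exact/subsetPset/ndG/leq_maxr.
move=> i; have [? ?] := Foo i; have [? ?] := Goo i; split.
  by rewrite -[X in measurable X]setTI; apply: mg => //; exact: measurableX.
rewrite /cons_measure /pushforward -comp_preimage gK preimage_id.
by rewrite product_measure1E// lte_mul_pinfty// ge0_fin_numE.
Qed.

HB.instance Definition _ := Measure_isSigmaFinite.Build _ _ _ cons_measure
  cons_measure_sigma_finite.

End ConsMeasure.

Fixpoint lebesgue_tuple (R : realType) (n : nat) :
    {sigma_finite_measure set (n.-tuple (measurableTypeR R)) -> \bar R} :=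
  match n with
  | 0 => dirac [tuple]
  | n'.+1 => cons_measure lebesgue_measure (lebesgue_tuple R n')
  end.

(* A differential form on R^d maps a point and a list of vectors to a number.
   Its degree is an integer, imposed by [Lam]: it vanishes on lists of any other
   length. So forms of negative degree or of degree > d are zero. *)
Definition dform (R : realType) (d : nat) : Type :=
  'rV[R]_d -> seq 'rV[R]_d -> R.

Section Forms.
Variables (R : realType) (d : nat).
Implicit Types (u v w : dform R d) (K : set 'rV[R]_d) (k : int) (r : nat).

Definition Lam k : set (dform R d) := [set u | forall x : 'rV[R]_d,
  [/\ forall vs : seq 'rV[R]_d, (size vs)%:Z != k -> u x vs = 0,
      forall (s1 s2 : seq 'rV[R]_d) (a : R) (y z : 'rV[R]_d),
        u x (s1 ++ (a *: y + z) :: s2) =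
          a * u x (s1 ++ y :: s2) + u x (s1 ++ z :: s2) &
      forall (s1 s2 : seq 'rV[R]_d) (y : 'rV[R]_d), u x (s1 ++ [:: y, y & s2]) = 0]].

Definition form0 : dform R d := fun _ _ => 0.

Definition vbasis_of (A : {set 'I_d}) : seq 'rV[R]_d :=
  [seq delta_mx 0 i | i <- enum A].

Definition dot u v (x : 'rV[R]_d) : R :=
  \sum_(A : {set 'I_d}) u x (vbasis_of A) * v x (vbasis_of A).

Definition inversions (m : seq bool) : nat :=
  \sum_(i < size m) \sum_(j < size m | (i < j)%N)
    (~~ nth false m i && nth false m j).

(* Sum over shuffles, encoded by the mask [m] of the vectors given to [u]. *)
Definition wedge u w : dform R d := fun x vs =>
  \sum_(m : (size vs).-tuple bool)
    (-1) ^+ inversions m * u x (mask m vs) * w x (mask (map negb m) vs).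

Definition ext_d u : dform R d := fun x vs =>
  \sum_(i < size vs) (-1) ^+ i *
    'D_(nth 0 vs i) (fun y => u y (take i vs ++ drop i.+1 vs)) x.

Definition contract (b : 'rV[R]_d) u : dform R d :=
  fun x vs => u x ((x - b) :: vs).

Definition row_of_tuple (t : d.-tuple (measurableTypeR R)) : 'rV[R]_d :=
  \row_i (tnth t i : R).

Definition int_fun K (f : 'rV[R]_d -> R) : R :=
  \int[lebesgue_tuple R d]_(t in row_of_tuple @^-1` K) f (row_of_tuple t).

(* Integral of the component of degree d, for the standard orientation of R^d *)
Definition int_form K u : R := int_fun K (fun x => u x (vbasis_of [set: 'I_d])).

Definition ip K u v : R := int_fun K (dot u v).

Definition barycentre K : 'rV[R]_d :=
  \row_i (int_fun K (fun x => x 0 i) / int_fun K (fun=> 1)).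

Definition kappa K u : dform R d := contract (barycentre K) u.

Definition iterD (vs : seq 'rV[R]_d) (f : 'rV[R]_d -> R) : 'rV[R]_d -> R :=
  foldr (fun (y : 'rV[R]_d) g x => 'D_y g x) f vs.

Definition smooth (f : 'rV[R]_d -> R) : Prop := forall vs x,
  {for x, continuous (iterD vs f)} /\ forall y, derivable (iterD vs f) x y.

Definition smooth_form k : set (dform R d) :=
  [set u | Lam k u /\ forall vs, smooth (fun x => u x vs)].

Definition test_form K k : set (dform R d) :=
  [set u | smooth_form k u /\ exists C : set 'rV[R]_d,
     [/\ compact C, C `<=` K° & forall x vs, ~ C x -> u x vs = 0]].

Definition L2 K : set (dform R d) := [set u | forall vs,
  let f := fun t : d.-tuple (measurableTypeR R) => u (row_of_tuple t) vs in
  measurable_fun (row_of_tuple @^-1` K) (f : _ -> measurableTypeR R) /\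
  (lebesgue_tuple R d).-integrable (row_of_tuple @^-1` K)
    (fun t => ((f t) ^+ 2)%:E)].

Definition is_weak_d K k u : set (dform R d) :=
  [set v | [/\ Lam (k + 1) v, L2 K v & forall phi, test_form K (d%:Z - k - 1) phi ->
     int_form K (wedge v phi) = - (-1) ^ k * int_form K (wedge u (ext_d phi))]].

Definition X K k : set (dform R d) :=
  [set u | [/\ Lam k u, L2 K u & exists v, is_weak_d K k u v]].

(* The exterior derivative of [u] in [X K k]; it is unique almost everywhere. *)
Definition weak_d K k u : dform R d := get (is_weak_d K k u).

(* The integral of [u /\ phi] on the boundary of [K], i.e. the pairing of the
   trace of [u] in [X K k] with a smooth form of degree d - k - 1 *)
Definition boundary_pairing K k u (phi : dform R d) : R :=
  int_form K (wedge (weak_d K k u) phi) +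
  (-1) ^ k * int_form K (wedge u (ext_d phi)).

Definition X0 K k : set (dform R d) := [set u | X K k u /\
  forall phi, smooth_form (d%:Z - k - 1) phi -> boundary_pairing K k u phi = 0].

Definition polynomial_fun (s : nat) (f : 'rV[R]_d -> R) : Prop :=
  exists p : mpoly.mpoly d R,
    (forall m : mpoly.multinom d, mpoly.mcoeff m p != 0 -> (mpoly.mdeg m <= s)%N) /\
    forall x, f x = mpoly.meval (fun i => x 0 i) p.

Definition P (s : nat) k : set (dform R d) :=
  [set u | Lam k u /\ forall vs, polynomial_fun s (fun x => u x vs)].

Definition Pminus K (s : nat) k : set (dform R d) :=
  [set u | P s k u /\ P s (k - 1) (kappa K u)].

Definition U K r k : set (dform R d) :=
  [set u | Pminus K r.+1 k u /\ forall v, P r k v -> ip K u v = 0].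

Definition W K r k : set (dform R d) :=
  [set w | exists a b, [/\ U K r (k - 1) a, U K r k b &
     w = fun x vs => ext_d a x vs + b x vs]].

Definition Z0 K r k : set (dform R d) := [set u | X0 K k u /\
  forall w, W K r (d%:Z - k) w -> int_form K (wedge u w) = 0].

Definition Y K r k : set (dform R d) := [set u | Z0 K r k u /\
  forall z, Z0 K r (k - 1) z -> ip K u (weak_d K (k - 1) z) = 0].

(* [g] is the image of [f] by the formal adjoint of d, from degree k to k - 1 *)
Definition is_dstar K k (f g : dform R d) : Prop :=
  forall phi, test_form K (k - 1) phi -> ip K g phi = ip K f (ext_d phi).

Definition G K r k : set (dform R d * dform R d) :=
  [set fg | [/\ P r.-1 k fg.1, P r.-1 (k - 1) fg.2,
     is_dstar K k fg.1 form0 & is_dstar K (k - 1) fg.2 form0]].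

Definition B_eqs K r k u (fg : dform R d * dform R d) a b v : Prop :=
  [/\ forall u', X0 K k u' ->
        ip K (weak_d K k u) (weak_d K k u') +
        int_form K (wedge (weak_d K k u') a) +
        int_form K (wedge u' b) +
        ip K u' (weak_d K (k - 1) v) = ip K fg.1 u',
      forall a', U K r (d%:Z - k - 1) a' ->
        int_form K (wedge (weak_d K k u) a') = 0,
      forall b', U K r (d%:Z - k) b' -> int_form K (wedge u b') = 0 &
      forall v', Y K r (k - 1) v' ->
        ip K u (weak_d K (k - 1) v') = ip K fg.2 v'].

Definition B K r k : set (dform R d) :=
  [set u | if d is 0 then Lam k u else
     X K k u /\ exists fg a b v, [/\ G K r k fg, U K r (d%:Z - k - 1) a,
       U K r (d%:Z - k) b, Y K r (k - 1) v & B_eqs K r k u fg a b v]].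

(* L2 projection onto a space of polynomial forms *)
Definition L2proj K (S : set (dform R d)) u : dform R d :=
  get [set q | S q /\ forall p, S p -> ip K u p = ip K q p].

End Forms.

Section Mesh.
Variable R : realType.

Definition unit_ball (d : nat) : set 'rV[R]_d :=
  [set x | \sum_i x 0 i ^+ 2 <= 1].

Definition bilipschitz_ball (d : nat) (K : set 'rV[R]_d) : Prop :=
  exists (f : 'rV[R]_d -> 'rV[R]_d) (C : R),
    f @` @unit_ball d = K /\
    forall x y, unit_ball x -> unit_ball y ->
      `|f x - f y| <= C * `|x - y| /\ `|x - y| <= C * `|f x - f y|.

Definition affine d N (o : 'rV[R]_N) (V : 'M[R]_(d, N)) (x : 'rV[R]_d) :
  'rV[R]_N := o + x *m V.

(* A finite complex of oriented flat cells in R^N. The rows of [frm c] are an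
   oriented orthonormal basis of the tangent space of [c], and [body c] is the
   cell in the resulting Cartesian coordinates with origin [org c]. Cells need
   not be convex. Points are positively oriented. *)
Record mesh (N : nat) := Mesh {
  cell : finType;
  cdim : cell -> nat;
  org : cell -> 'rV[R]_N;
  frm : forall c, 'M[R]_(cdim c, N);
  body : forall c, set 'rV[R]_(cdim c);
  frm_orthonormal : forall c, frm c *m (frm c)^T = 1%:M;
  body_ball : forall c, bilipschitz_ball (@body c);
  interior_disjoint : forall c c', c != c' ->
    affine (org c) (frm c) @` (@body c)° `&`
    affine (org c') (frm c') @` (@body c')° = set0;
  boundary_cells : forall c x, (@body c `\` (@body c)°) x -> exists c',
    (affine (org c') (frm c') @` @body c') (affine (org c) (frm c) x) /\
    affine (org c') (frm c') @` @body c' `<=`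
      affine (org c) (frm c) @` (@body c `\` (@body c)°)
}.
Arguments body {N m} c.

Variables (N : nat) (M : mesh N).
Implicit Types (T F : cell M) (k : int) (r : nat).

Definition embed T : 'rV[R]_(cdim T) -> 'rV[R]_N := affine (org T) (frm T).

Definition face F T : bool :=
  `[< @embed F @` body F `<=` @embed T @` body T >].

Definition facet F T : bool := face F T && ((cdim F).+1 == cdim T).

(* The inclusion of [F] in [T], in the coordinates of the cells, and its
   differential *)
Definition incl F T (x : 'rV[R]_(cdim F)) : 'rV[R]_(cdim T) :=
  (embed x - org T) *m (frm T)^T.
Definition dincl F T : 'M[R]_(cdim F, cdim T) := frm F *m (frm T)^T.

Definition pullback F T (u : dform R (cdim T)) : dform R (cdim F) :=
  fun x vs => u (incl T x) [seq v *m dincl F T | v <- vs].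

Definition outward_normal F T : set 'rV[R]_(cdim T) :=
  [set n | [/\ n *m n^T = 1%:M, dincl F T *m n^T = 0 &
    forall x : 'rV[R]_(cdim F), (body F)° x -> \forall t \near (0 : R)^'+,
      body T (incl T x - t *: n) /\ ~ body T (incl T x + t *: n)]].

(* Orientation of the facet [F] relative to the boundary orientation: the
   orientation of (outward normal, frame of F) relative to the frame of T *)
Definition incidence F T : R :=
  \det (\matrix_(i < cdim T) nth 0
    (get (@outward_normal F T) ::
      [seq row i (dincl F T) | i <- enum 'I_(cdim F)]) i).

(* [tr] is the family of the traces of [u] on the faces of [T]. The trace on
   the facets of a face [c] of a form of [X (body c) k] is the extension of the
   pullback of smooth forms by duality, i.e. by the formula of Stokes. *)
Definition is_traces k T (u : dform R (cdim T)) :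
    set (forall c, dform R (cdim c)) :=
  [set tr | tr T = u /\ forall c, face c T -> X (body c) k (tr c) /\
    forall phi, smooth_form ((cdim c)%:Z - k - 1) phi ->
      boundary_pairing (body c) k (tr c) phi =
      \sum_(F | facet F c) incidence F c *
        int_form (body F) (wedge (tr F) (pullback phi))].

Definition trace k T (u : dform R (cdim T)) : forall c, dform R (cdim c) :=
  get (is_traces k u).
Arguments trace k {T} u c.

Definition A r k T : set (dform R (cdim T)) :=
  [set u | [/\ X (body T) k u, exists tr, is_traces k u tr &
     forall c, face c T -> B (body c) r k (trace k u c)]].

End Mesh.
Arguments body {R N m} c.
Arguments trace {R N M} k {T} u c.

(* Operations on polynomial forms on a cell. [Proj m s l] is the L2 projection
   on P^s_- Lambda^l if [m], and on P^s Lambda^l otherwise. *)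
Inductive form_expr : Type :=
| Input
| One
| Add of form_expr & form_expr
| Scale of scal_expr & form_expr
| Wedge of form_expr & form_expr
| Der of form_expr
| Koszul of form_expr
| Proj of bool & nat & int & form_expr
with scal_expr : Type :=
| Const of rat
| SAdd of scal_expr & scal_expr
| SMul of scal_expr & scal_expr
| SInv of scal_expr
| Int of form_expr.

Section Eval.
Variables (R : realType) (d : nat) (K : set 'rV[R]_d) (w : dform R d).

Fixpoint eval_form (e : form_expr) : dform R d :=
  match e with
  | Input => w
  | One => fun _ vs => (vs == [::])%:R
  | Add e1 e2 => fun x vs => eval_form e1 x vs + eval_form e2 x vs
  | Scale c e1 => fun x vs => eval_scal c * eval_form e1 x vs
  | Wedge e1 e2 => wedge (eval_form e1) (eval_form e2)
  | Der e1 => ext_d (eval_form e1)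
  | Koszul e1 => kappa K (eval_form e1)
  | Proj m s l e1 =>
      L2proj K (if m then Pminus K s l else @P R d s l) (eval_form e1)
  end
with eval_scal (c : scal_expr) : R :=
  match c with
  | Const q => ratr q
  | SAdd c1 c2 => eval_scal c1 + eval_scal c2
  | SMul c1 c2 => eval_scal c1 * eval_scal c2
  | SInv c1 => (eval_scal c1)^-1
  | Int e => int_form K (eval_form e)
  end.

End Eval.

(* One step of an inductive procedure, for the moment against the input form w
   on a cell T. A pair (c, e) of [local_terms] stands for c(w) times the degree
   of freedom against e(w) on T. A triple (c, e, g) of [facet_terms] stands for
   c(w) times the sum, over the facets F of T, counted with their incidence
   number, of the moment against g(e(w)|F) on F, computed recursively. *)
Record step : Type := Step {
  local_terms : seq (scal_expr * form_expr);
  facet_terms : seq (scal_expr * form_expr * form_expr)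
}.

Section Run.
Variables (R : realType) (N : nat) (M : mesh R N) (Q : nat -> step).

(* The linear combination of degrees of freedom that the procedure [Q] (one step
   per dimension of cells) returns, as a list of coefficients, cells and forms
   on these cells; [n] bounds the depth of the recursion. *)
Fixpoint run_rec (n : nat) (T : cell M) (w : dform R (cdim T)) :
    seq (R * {c : cell M & dform R (cdim c)}) :=
  [seq (eval_scal (body T) w t.1,
        existT (fun c => dform R (cdim c)) T (eval_form (body T) w t.2))
     | t <- local_terms (Q (cdim T))] ++
  match n with
  | 0 => [::]
  | n'.+1 => flatten [seq flatten
      [seq [seq (incidence F T * eval_scal (body T) w t.1.1 * q.1, q.2)
              | q <- @run_rec n' F (eval_form (body F)
                  (pullback (F := F) (eval_form (body T) w t.1.2)) t.2)]
         | F <- enum [pred F | facet F T]]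
    | t <- facet_terms (Q (cdim T))]
  end.

Definition run (T : cell M) (w : dform R (cdim T)) := run_rec (cdim T) w.

End Run.

(* Main.v *)
Require Import Defs.
From mathcomp Require Import all_boot all_order all_algebra.
From mathcomp Require Import all_classical all_reals all_analysis.
From mathcomp Require Import measurable_realfun ring lra zify.
From mathcomp Require mpoly.
Import -(notations) mpoly.
From Stdlib Require List.
Import Order.TTheory GRing.Theory Num.Theory.
Import numFieldNormedType.Exports.
Set Implicit Arguments.
Unset Strict Implicit.
Unset Printing Implicit Defensive.
Local Open Scope classical_set_scope.
Local Open Scope ring_scope.

#[local] Notation contract := Defs.contract.
#[local] Notation incl := Defs.incl.

(** Write [l = d - k] for the degree of the test form [w] on a cell [T] of
    dimension [d]. Two facts make the induction on the faces work.

    Algebra. For a polynomial form [w] of degree at most [r], Cartan's formula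
    for the Koszul operator [kappa] says that [d kappa + kappa d] is the Lie
    derivative along [x - b], which multiplies the homogeneous part of degree
    [r] by [r + l]. Hence, for the potential [alpha = kappa w / (r + l)], the
    difference [w - d alpha] is a multiple of [kappa d w] plus terms of degree
    at most [r - 1], and belongs to [P^r_-] ([Pminus_sub_ext_d_kappa]): up to an
    exact form, [w] is a test form of a degree of freedom.

    Analysis. The potential is polynomial of degree [r + 1], so it differs from
    its projection onto [P^r] by an element [gamma] of [U^(l-1)(T)], the
    corrector. Replacing [alpha] by [gamma] changes [w - d alpha] by the
    derivative of an element of [P^r], which is again in [P^r_-]
    ([Pminus_local]). Thus [w] is the sum of [w - d gamma], against which the
    moment of [u] is a degree of freedom, and of [d gamma]. By the formula of
    Stokes, the moment of [u] against [d gamma] is, up to sign, the sum of the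
    moments on the facets [F] of the trace of [u] against the trace of [gamma],
    because [du] has zero moment against [gamma]: this is one of the equations
    that define [B^k(T)]. The
    trace of [gamma] on [F] is in [P^(r+1)_-(F)], so it differs from its
    projection onto [P^r(F)] by an element of [U(F)], against which another
    equation of [B^k(F)] makes the moment of [u] vanish ([int_wedge_L2proj]).
    What remains is a moment against a form of [P^r(F)], in lower dimension.

    The other lemmas support these two facts: polynomial functions are smooth
    with derivatives of lower degree; cells are compact, hence measurable with
    finite measure, so that products of an [L2] form and a polynomial form can be
    integrated termwise; and the projection onto [P^r] exists
    ([L2_projection_exists]), although the scalar product of forms is only
    known to be semidefinite. *)

(** * Polynomial functions *)

Section PolynomialFunctions.
Variables (R : realType) (d : nat).
Implicit Types (f g : 'rV[R]_d -> R) (s : nat).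

Lemma mdeg_neq0_ex (m : mpoly.multinom d) : mpoly.mdeg m != 0%N ->
  exists i, (0 < m i)%N.
Proof.
rewrite mpoly.mdegE sum_nat_eq0 => /forallPn[i]; rewrite implyTb => mi.
by exists i; rewrite lt0n.
Qed.

Lemma polynomial_fun_monomial s c (m : mpoly.multinom d) :
  (mpoly.mdeg m <= s)%N ->
  polynomial_fun s (fun x : 'rV[R]_d => c * \prod_i x 0 i ^+ m i).
Proof.
move=> ms; exists (c *: mpoly.mpolyX R m); split.
  move=> m'; rewrite mpoly.mcoeffZ mpoly.mcoeffX.
  by case: (eqVneq m m') => [<- _ //|_]; rewrite mulr0 eqxx.
by move=> x; rewrite mpoly.mevalZ mpoly.mevalX.
Qed.

(** Building monomials by multiplying by one coordinate at a time reduces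
    differentiability, measurability and the like to the case of a coordinate,
    without reference to coefficients. *)
Lemma polynomial_fun_ind (Q : nat -> ('rV[R]_d -> R) -> Prop) :
  (forall s c, Q s (fun=> c)) ->
  (forall s f g, Q s f -> Q s g -> Q s (fun x => f x + g x)) ->
  (forall s i f, polynomial_fun s f -> Q s f -> Q s.+1 (fun x => x 0 i * f x)) ->
  forall s f, polynomial_fun s f -> Q s f.
Proof.
move=> Qc QD QX.
have mono s (m : mpoly.multinom d) c : (mpoly.mdeg m <= s)%N ->
    Q s (fun x => c * \prod_i x 0 i ^+ m i).
  elim: s => [|s IHs] in m c * => ms.
    suff -> : (fun x : 'rV[R]_d => c * \prod_i x 0 i ^+ m i) = fun=> c by exact: Qc.
    apply/funext => x; rewrite big1 ?mulr1// => i _.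
    move: ms; rewrite leqn0 mpoly.mdegE sum_nat_eq0 => /forallP/(_ i).
    by rewrite implyTb => /eqP ->.
  have [m0|/mdeg_neq0_ex[i mi]] := eqVneq (mpoly.mdeg m) 0%N.
    suff -> : (fun x : 'rV[R]_d => c * \prod_i x 0 i ^+ m i) = fun=> c by exact: Qc.
    apply/funext => x; rewrite big1 ?mulr1// => i _.
    move/eqP: m0; rewrite mpoly.mdegE sum_nat_eq0 => /forallP/(_ i).
    by rewrite implyTb => /eqP ->.
  pose m' := mpoly.mnm_sub m (mpoly.mnm1 i).
  have mE : m = mpoly.mnm_add (mpoly.mnm1 i) m'.
    apply/mpoly.mnmP => j; rewrite mpoly.mnmDE mpoly.mnmBE mpoly.mnm1E.
    by case: eqVneq => [<-|_] /=; rewrite ?add0n ?subn0// subnKC.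
  have m's : (mpoly.mdeg m' <= s)%N.
    by move: ms; rewrite mE mpoly.mdegD mpoly.mdeg1 add1n ltnS.
  have -> : (fun x : 'rV[R]_d => c * \prod_i x 0 i ^+ m i) =
      fun x => x 0 i * (c * \prod_i x 0 i ^+ m' i).
    apply/funext => x; rewrite mulrCA; congr (_ * _).
    rewrite (bigD1 i)//= [in RHS](bigD1 i)//= mulrA; congr (_ * _).
      by rewrite mE mpoly.mnmDE mpoly.mnm1E eqxx exprD expr1.
    apply: eq_bigr => j ji; rewrite mE mpoly.mnmDE mpoly.mnm1E.
    by rewrite eq_sym (negbTE ji).
  by apply: QX; [exact: polynomial_fun_monomial|exact: IHs].
move=> s f [p [ps fE]].
have -> : f = fun x => \sum_(m <- mpoly.msupp p)
    mpoly.mcoeff m p * \prod_i x 0 i ^+ m i.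
  by apply/funext => x; rewrite fE mpoly.mevalE.
have : {in mpoly.msupp p, forall m, (mpoly.mdeg m <= s)%N}.
  by move=> m; rewrite mpoly.mcoeff_msupp => /ps.
elim: (mpoly.msupp p : seq _) => [|m ms IH] ls.
  suff -> : (fun x : 'rV[R]_d => \sum_(m <- [::]) mpoly.mcoeff m p *
      \prod_i x 0 i ^+ m i) = fun=> 0 by exact: Qc.
  by apply/funext => x; rewrite big_nil.
rewrite (_ : (fun _ : 'rV[R]_d => _) = fun x : 'rV[R]_d => mpoly.mcoeff m p * \prod_i x 0 i ^+ m i +
    \sum_(m <- ms) mpoly.mcoeff m p * \prod_i x 0 i ^+ m i); last first.
  by apply/funext => x; rewrite big_cons.
apply: QD; first by apply mono; apply: ls; rewrite mem_head.
by apply: IH => m' m'ms; apply: ls; rewrite in_cons m'ms orbT.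
Qed.

Lemma polynomial_fun_cst s c : polynomial_fun s (fun _ : 'rV[R]_d => c).
Proof.
exists (mpoly.mpolyC d c); split; last by move=> x; rewrite mpoly.mevalC.
move=> m; rewrite mpoly.mcoeffC; case: (eqVneq m mnm0) => [->|_]; first by rewrite mpoly.mdeg0.
by rewrite mulr0 eqxx.
Qed.

Lemma polynomial_funD s f g : polynomial_fun s f -> polynomial_fun s g ->
  polynomial_fun s (fun x => f x + g x).
Proof.
move=> [p [ps fE]] [q [qs gE]]; exists (p + q); split.
  move=> m; rewrite mpoly.mcoeffD; have [->|/ps//] := eqVneq (mpoly.mcoeff m p) 0.
  by rewrite add0r; exact: qs.
by move=> x; rewrite mpoly.mevalD fE gE.
Qed.

Lemma polynomial_funZ s a f : polynomial_fun s f ->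
  polynomial_fun s (fun x => a * f x).
Proof.
move=> [p [ps fE]]; exists (a *: p); split.
  move=> m; rewrite mpoly.mcoeffZ mulf_eq0 negb_or => /andP[_]; exact: ps.
by move=> x; rewrite mpoly.mevalZ fE.
Qed.

Lemma polynomial_funW s t f : (s <= t)%N -> polynomial_fun s f -> polynomial_fun t f.
Proof.
by move=> st [p [ps fE]]; exists p; split=> // m /ps /leq_trans; exact.
Qed.

Lemma polynomial_fun_sum s (I : Type) (r : seq I) (F : I -> 'rV[R]_d -> R) :
  (forall i, polynomial_fun s (F i)) ->
  polynomial_fun s (fun x => \sum_(i <- r) F i x).
Proof.
move=> sF; elim: r => [|i r IH].
  rewrite (_ : (fun _ : 'rV[R]_d => _) = fun _ : 'rV[R]_d => 0); first exact: polynomial_fun_cst.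
  by apply/funext => x; rewrite big_nil.
rewrite (_ : (fun _ : 'rV[R]_d => _) = fun x : 'rV[R]_d => F i x + \sum_(i <- r) F i x).
  exact: polynomial_funD.
by apply/funext => x; rewrite big_cons.
Qed.

Lemma polynomial_funX s i f : polynomial_fun s f ->
  polynomial_fun s.+1 (fun x => x 0 i * f x).
Proof.
move=> [p [ps fE]]; exists (p * mpoly.mpolyX R (mpoly.mnm1 i)); split; last first.
  by move=> x; rewrite mpoly.mevalM mpoly.mevalXU fE mulrC.
move=> m; rewrite -mpoly.mcoeff_msupp => /mpoly.msuppM_le /allpairsP[[m1 m2] /=].
rewrite mpoly.msuppX mpoly.mcoeff_msupp => -[/ps m1s].
by rewrite inE => /eqP -> ->; rewrite mpoly.mdegD mpoly.mdeg1 addn1 ltnS.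
Qed.

End PolynomialFunctions.

(** * Derivatives of polynomial functions *)

Section PolynomialDerivatives.
Variables (R : realType) (d : nat).
Implicit Types (f g : 'rV[R]_d -> R) (s : nat).

Lemma differentiable_polynomial s f x : polynomial_fun s f -> differentiable f x.
Proof.
move: s f; apply: (@polynomial_fun_ind R d (fun _ f => differentiable f x)).
- by move=> _ c; exact: differentiable_cst.
- by move=> _ f g df dg; exact: differentiableD.
- by move=> _ i f _ df; apply: differentiableM => //; exact: differentiable_coord.
Qed.

Lemma derivable_polynomial s f x v : polynomial_fun s f -> derivable f x v.
Proof. by move=> /differentiable_polynomial df; exact/diff_derivable. Qed.

Lemma continuous_polynomial s f : polynomial_fun s f -> continuous f.
Proof.
by move=> fs x; apply: differentiable_continuous; exact: differentiable_polynomial fs.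
Qed.

Lemma derive_linear_dir s f x a v w : polynomial_fun s f ->
  'D_(a *: v + w) f x = a * 'D_v f x + 'D_w f x.
Proof.
move=> fs; have df : differentiable f x := differentiable_polynomial x fs.
by rewrite !deriveE// linearP.
Qed.

Lemma derive_polyD s t f g x v : polynomial_fun s f -> polynomial_fun t g ->
  'D_v (fun x => f x + g x) x = 'D_v f x + 'D_v g x.
Proof. by move=> fs gt; apply: deriveD; [exact: derivable_polynomial fs|exact: derivable_polynomial gt]. Qed.

Lemma derive_polyZ s f x v a : polynomial_fun s f ->
  'D_v (fun x => a * f x) x = a * 'D_v f x.
Proof. by move=> fs; apply: deriveZ; exact: derivable_polynomial fs. Qed.

Lemma derive_coord i x v : is_derive x v (fun y : 'rV[R]_d => y 0 i) (v 0 i).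
Proof.
have dc := @differentiable_coord R 1 d x 0 i.
apply: DeriveDef; first exact: diff_derivable.
rewrite deriveE//.
have @f : {linear 'rV[R]_d -> R}.
  by exists (fun N : 'rV[R]_d => N 0 i); do 2![eexists]; do ?[constructor];
     rewrite ?mxE// => ? *; rewrite ?mxE//; move=> ?; rewrite !mxE.
by have /= -> := @diff_lin R _ _ f x (@coord_continuous R 1 d 0 i).
Qed.

Lemma derive_polyX s f i x v : polynomial_fun s f ->
  'D_v (fun y : 'rV[R]_d => y 0 i * f y) x = v 0 i * f x + x 0 i * 'D_v f x.
Proof.
move=> fs; have dc := derive_coord i x v.
have df : derivable f x v := derivable_polynomial fs.
by rewrite deriveM// derive_val addrC /GRing.scale/= [f x * _]mulrC.
Qed.

(** The degree of a derivative is at most [s - 1]. When [s = 0] this means that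
    the derivative is zero, which truncated subtraction would lose, and which the
    induction on the degree needs. *)
Definition polynomial_lt s f : Prop :=
  if s is s'.+1 then polynomial_fun s' f else f = fun=> 0.

Lemma polynomial_lt_pred s f : polynomial_lt s f -> polynomial_fun s.-1 f.
Proof. by case: s => [->|s //]; exact: polynomial_fun_cst. Qed.

Lemma polynomial_ltD s f g : polynomial_lt s f -> polynomial_lt s g ->
  polynomial_lt s (fun x => f x + g x).
Proof.
case: s => [-> ->|s]; last exact: polynomial_funD.
by apply/funext => x; rewrite addr0.
Qed.

Lemma polynomial_ltX s i f : polynomial_lt s f ->
  polynomial_lt s.+1 (fun x => x 0 i * f x).
Proof.
case: s => [->|s]; last exact: polynomial_funX.
rewrite (_ : (fun _ : 'rV[R]_d => _) = fun=> 0); first exact: polynomial_fun_cst.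
by apply/funext => x; rewrite mulr0.
Qed.

Lemma polynomial_lt0 s : polynomial_lt s (fun=> 0).
Proof. by case: s => [//|s]; exact: polynomial_fun_cst. Qed.

(** Both bounds are proved together, for the same induction. The second one holds
    because the derivative along [x - b] multiplies the homogeneous part of
    degree [s] by [s], up to terms of lower degree. *)
Lemma polynomial_derive_euler s f :
  polynomial_fun s f ->
  (forall v, polynomial_lt s ('D_v f)) /\
  (forall b, polynomial_lt s (fun x => 'D_(x - b) f x - s%:R * f x)).
Proof.
move=> fs; suff [_] : polynomial_fun s f /\
  ((forall v, polynomial_lt s ('D_v f)) /\
   (forall b, polynomial_lt s (fun x => 'D_(x - b) f x - s%:R * f x))) by [].
move: s f fs; apply: (@polynomial_fun_ind R d (fun s f => polynomial_fun s f /\ _)).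
- move=> s c; split; first exact: polynomial_fun_cst.
  split=> [v|b].
    rewrite (_ : 'D_v _ = fun=> 0); first exact: polynomial_lt0.
    by apply/funext => x; exact: derive_cst.
  have -> : (fun x : 'rV[R]_d => 'D_(x - b) (fun=> c) x - s%:R * c) = fun=> - (s%:R * c).
    by apply/funext => x; rewrite derive_cst sub0r.
  case: s => [|s]; last exact: polynomial_fun_cst.
  by apply/funext => x; rewrite mul0r oppr0.
- move=> s f g [fs [f1 f2]] [gs [g1 g2]]; split; first exact: polynomial_funD.
  split=> [v|b].
    rewrite (_ : 'D_v _ = fun x => 'D_v f x + 'D_v g x); first exact: polynomial_ltD.
    by apply/funext => x; rewrite (derive_polyD _ _ fs gs).
  rewrite (_ : (fun _ : 'rV[R]_d => _) = fun x => ('D_(x - b) f x - s%:R * f x) +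
    ('D_(x - b) g x - s%:R * g x)); first exact: polynomial_ltD.
  by apply/funext => x; rewrite (derive_polyD _ _ fs gs); ring.
- move=> s i f fs [_ [f1 f2]]; split; first exact: polynomial_funX.
  split=> [v|b].
    rewrite (_ : 'D_v _ = fun x => v 0 i * f x + x 0 i * 'D_v f x).
      by apply: polynomial_funD; [exact: polynomial_funZ|exact: polynomial_ltX].
    by apply/funext => x; rewrite (derive_polyX _ _ _ fs).
  rewrite (_ : (fun _ : 'rV[R]_d => _) =
      fun x => x 0 i * ('D_(x - b) f x - s%:R * f x) + (- b 0 i) * f x).
    by apply: polynomial_funD; [exact: polynomial_ltX|exact: polynomial_funZ].
  apply/funext => x; rewrite (derive_polyX _ _ _ fs) !mxE -natr1; ring.
Qed.

Lemma polynomial_derive s f v : polynomial_fun s f -> polynomial_fun s.-1 ('D_v f).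
Proof. by move=> /polynomial_derive_euler[/(_ v)/polynomial_lt_pred]. Qed.

Lemma polynomial_euler s f b : polynomial_fun s.+1 f ->
  polynomial_fun s (fun x => 'D_(x - b) f x - s.+1%:R * f x).
Proof. by move=> /polynomial_derive_euler[_ /(_ b)]. Qed.

Lemma smooth_polynomial s f : polynomial_fun s f -> smooth f.
Proof.
move=> fs vs x.
have : polynomial_fun s (Defs.iterD vs f).
  elim: vs => [//|v vs IH]; apply: polynomial_funW (polynomial_derive v IH).
  exact: leq_pred.
by move=> Ps; split=> [|y]; [exact: (@continuous_polynomial s _ Ps x)|exact: derivable_polynomial Ps].
Qed.

End PolynomialDerivatives.

(** * Alternating forms, exterior derivative and Koszul operator *)

Section PolynomialForms.
Variables (R : realType) (d : nat).
Implicit Types (u v w : dform R d) (k : int) (b : 'rV[R]_d).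
Implicit Types (vs : seq 'rV[R]_d).

Lemma Lam_size k u x vs : Lam k u -> (size vs)%:Z != k -> u x vs = 0.
Proof. by move=> /(_ x)[+ _ _]; exact. Qed.

Lemma Lam_lin k u x s1 s2 a y z : Lam k u ->
  u x (s1 ++ (a *: y + z) :: s2) = a * u x (s1 ++ y :: s2) + u x (s1 ++ z :: s2).
Proof. by move=> /(_ x)[_ + _]; exact. Qed.

Lemma Lam_alt k u x s1 s2 y : Lam k u -> u x (s1 ++ [:: y, y & s2]) = 0.
Proof. by move=> /(_ x)[_ _]; exact. Qed.

Lemma Lam_swap k u x s1 s2 y z : Lam k u ->
  u x (s1 ++ [:: y, z & s2]) = - u x (s1 ++ [:: z, y & s2]).
Proof.
move=> uk; have := Lam_alt x s1 s2 (y + z) uk.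
rewrite -{1}[y]scale1r (Lam_lin _ _ _ _ _ _ uk) mul1r.
have E t : s1 ++ [:: t, y + z & s2] = (s1 ++ [:: t]) ++ (1 *: y + z) :: s2.
  by rewrite -catA scale1r.
rewrite !E !(Lam_lin _ _ _ _ _ _ uk) !mul1r -!catA !cat1s !(Lam_alt _ _ _ _ uk).
by rewrite add0r addr0 => /eqP; rewrite addr_eq0 => /eqP.
Qed.

(** Moving the vector of index [i] to the front exchanges it with [i] vectors. *)
Lemma Lam_front k u x s0 vs i : Lam k u -> (i < size vs)%N ->
  u x (s0 ++ nth 0 vs i :: take i vs ++ drop i.+1 vs) = (-1) ^+ i * u x (s0 ++ vs).
Proof.
move=> uk; elim: vs s0 i => // v vs IH s0 [_|i /=]; first by rewrite expr0 mul1r /= drop0.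
rewrite ltnS => ivs; rewrite (Lam_swap _ _ _ _ _ uk) exprS mulN1r mulNr; congr (- _).
by have := IH (s0 ++ [:: v]) i ivs; rewrite -!catA !cat1s.
Qed.

Lemma Lam0 k : Lam k (fun (_ : 'rV[R]_d) _ => 0).
Proof. by move=> x; split=> // *; rewrite mulr0 addr0. Qed.

Lemma LamD k u v : Lam k u -> Lam k v -> Lam k (fun x vs => u x vs + v x vs).
Proof.
move=> uk vk x; split=> [vs sk|s1 s2 a y z|s1 s2 y].
- by rewrite (Lam_size _ uk)// (Lam_size _ vk)// addr0.
- by rewrite (Lam_lin _ _ _ _ _ _ uk) (Lam_lin _ _ _ _ _ _ vk); ring.
- by rewrite (Lam_alt _ _ _ _ uk) (Lam_alt _ _ _ _ vk) addr0.
Qed.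

Lemma LamZ k a u : Lam k u -> Lam k (fun x vs => a * u x vs).
Proof.
move=> uk x; split=> [vs sk|s1 s2 c y z|s1 s2 y].
- by rewrite (Lam_size _ uk)// mulr0.
- by rewrite (Lam_lin _ _ _ _ _ _ uk); ring.
- by rewrite (Lam_alt _ _ _ _ uk) mulr0.
Qed.

(** This expansion turns a form evaluated on a vector that depends on the point
    into a combination, with polynomial coefficients, of components. *)
Lemma Lam_head_sum k u x y vs : Lam k u ->
  u x (y :: vs) = \sum_i y 0 i * u x (delta_mx 0 i :: vs).
Proof.
move=> uk; rewrite {1}(row_sum_delta y).
have u0 : u x (0 :: vs) = 0.
  have := Lam_lin x [::] vs (-1) 0 0 uk; rewrite /= scaler0 addr0 => ->.
  by rewrite mulN1r addNr.
elim/big_rec2: _ => // i c z _ <-.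
exact: (Lam_lin x [::] vs _ _ _ uk).
Qed.

Lemma P_Lam s k u : P s k u -> Lam k u. Proof. by case. Qed.

Lemma P_poly s k u vs : P s k u -> polynomial_fun s (u ^~ vs). Proof. by case. Qed.

Lemma P0 s k : P s k (fun (_ : 'rV[R]_d) _ => 0).
Proof. by split; [exact: Lam0|move=> vs; exact: polynomial_fun_cst]. Qed.

Lemma PD s k u v : P s k u -> P s k v -> P s k (fun x vs => u x vs + v x vs).
Proof.
move=> [uk us] [vk vs]; split; first exact: LamD.
by move=> t; exact: polynomial_funD.
Qed.

Lemma PZ s k a u : P s k u -> P s k (fun x vs => a * u x vs).
Proof.
by move=> [uk us]; split; [exact: LamZ|move=> t; exact: polynomial_funZ].
Qed.

Lemma PW s t k u : (s <= t)%N -> P s k u -> P t k u.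
Proof. by move=> st [uk us]; split=> // vs; exact: polynomial_funW (us vs). Qed.

Lemma P_smooth s k u : P s k u -> smooth_form k u.
Proof. by move=> [uk us]; split=> // vs; exact: smooth_polynomial (us vs). Qed.

Lemma Lam_contract k b u : Lam k u -> Lam (k - 1) (contract b u).
Proof.
move=> uk x; rewrite /contract; split=> [vs sk|s1 s2 a y z|s1 s2 y].
- apply: (Lam_size _ uk); apply: contra_neq sk => <-.
  by rewrite /= intS addrC addKr.
- exact: (Lam_lin x (_ :: s1) s2 _ _ _ uk).
- exact: (Lam_alt x (_ :: s1) s2 _ uk).
Qed.

Lemma contractE k b u x vs : Lam k u ->
  contract b u x vs = \sum_i (x 0 i - b 0 i) * u x (delta_mx 0 i :: vs).
Proof.
move=> uk; rewrite /contract (Lam_head_sum _ _ _ uk).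
by apply: eq_bigr => i _; rewrite !mxE.
Qed.

Lemma polynomial_shiftX s f i (c : R) : polynomial_fun s f ->
  polynomial_fun s.+1 (fun x : 'rV[R]_d => (x 0 i - c) * f x).
Proof.
move=> fs; have -> : (fun x : 'rV[R]_d => (x 0 i - c) * f x) =
    fun x => x 0 i * f x + (- c) * f x.
  by apply/funext => x; rewrite mulrDl.
apply: polynomial_funD; first exact: polynomial_funX.
by apply: polynomial_funZ; exact: polynomial_funW fs.
Qed.

Lemma P_contract s k b u : P s k u -> P s.+1 (k - 1) (contract b u).
Proof.
move=> us; split; first exact: Lam_contract (P_Lam us).
move=> vs; have -> : (contract b u)^~ vs =
    fun x => \sum_i (x 0 i - b 0 i) * u x (delta_mx 0 i :: vs).
  by apply/funext => x; rewrite (contractE _ _ _ (P_Lam us)).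
by apply: polynomial_fun_sum => i; apply: polynomial_shiftX; exact: P_poly us.
Qed.

Lemma P_contract_cst s k (c : 'rV[R]_d) u : P s k u ->
  P s (k - 1) (fun x vs => u x (c :: vs)).
Proof.
move=> [uk us]; split=> [x|vs]; last exact: us.
split=> [vs sk|s1 s2 a y z|s1 s2 y].
- apply: (Lam_size _ uk); apply: contra_neq sk => <-.
  by rewrite /= intS addrC addKr.
- exact: (Lam_lin x (_ :: s1) s2 _ _ _ uk).
- exact: (Lam_alt x (_ :: s1) s2 _ uk).
Qed.

Lemma del_cat_lt i (s1 s2 : seq 'rV[R]_d) : (i < size s1)%N ->
  take i (s1 ++ s2) ++ drop i.+1 (s1 ++ s2) = (take i s1 ++ drop i.+1 s1) ++ s2.
Proof.
move=> i1; rewrite take_cat i1 drop_cat -catA; congr (_ ++ _).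
case: ltnP => // h; have -> : i.+1 = size s1 by apply/eqP; rewrite eqn_leq i1 h.
by rewrite subnn drop0 drop_size.
Qed.

Lemma del_cat_ge i (s1 s2 : seq 'rV[R]_d) : (size s1 <= i)%N ->
  take i (s1 ++ s2) ++ drop i.+1 (s1 ++ s2) =
  s1 ++ take (i - size s1) s2 ++ drop (i - size s1).+1 s2.
Proof.
move=> i1; rewrite take_cat ltnNge i1/= drop_cat ltnNge (leq_trans i1)//=.
by rewrite -catA subSn.
Qed.

Definition ext_d_term u x vs (i : nat) : R :=
  (-1) ^+ i * 'D_(nth 0 vs i) (fun y => u y (take i vs ++ drop i.+1 vs)) x.

Lemma ext_d_termP s k u x s1 s2 a y z i : P s k u ->
  ext_d_term u x (s1 ++ (a *: y + z) :: s2) i =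
  a * ext_d_term u x (s1 ++ y :: s2) i + ext_d_term u x (s1 ++ z :: s2) i.
Proof.
move=> us; rewrite /ext_d_term mulrCA -mulrDr; congr (_ * _).
have P1 := P_poly _ us.
case: (ltngtP i (size s1)) => [i1|i1|->].
- rewrite !nth_cat i1 !del_cat_lt//.
  rewrite -(derive_polyZ _ _ _ (P1 _)) -(derive_polyD _ _ (polynomial_funZ _ (P1 _)) (P1 _)).
  congr ('D_ _ _ _); apply/funext => t; exact: Lam_lin (P_Lam us).
- rewrite !nth_cat ltnNge (ltnW i1)/= !del_cat_ge ?(ltnW i1)//.
  move: i1; rewrite -subn_gt0; case: (i - size s1)%N => // j _ /=.
  rewrite -(derive_polyZ _ _ _ (P1 _)) -(derive_polyD _ _ (polynomial_funZ _ (P1 _)) (P1 _)).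
  congr ('D_ _ _ _); apply/funext => t; exact: Lam_lin (P_Lam us).
- rewrite !nth_cat ltnn subnn/= !del_cat_ge// subnn/= !drop0.
  exact: (derive_linear_dir _ _ _ _ (P1 _)).
Qed.

(** Linearity in each vector uses that a polynomial function is differentiable, so
    that its directional derivatives are linear in the direction. *)
Lemma Lam_ext_d s k u : P s k u -> Lam (k + 1) (ext_d u).
Proof.
move=> us x; split=> [vs sk|s1 s2 a y z|s1 s2 y].
- rewrite /ext_d big1// => i _.
  rewrite (_ : (fun _ => _) = cst 0) ?derive_cst ?mulr0//.
  apply/funext => y; apply: (Lam_size _ (P_Lam us)).
  apply: contra_neq sk => <-.
  rewrite size_cat size_take size_drop ltn_ord -PoszD; congr Posz.
  by have := ltn_ord i; lia.
- rewrite /ext_d !size_cat /= mulr_sumr -big_split /=.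
  apply: eq_bigr => i _; exact: ext_d_termP us.
- rewrite /ext_d; set vs := s1 ++ _.
  have sv : size vs = (size s1 + (size s2).+2)%N by rewrite size_cat.
  have i1 : (size s1 < size vs)%N by rewrite sv -addSnnS leq_addr.
  have i2 : ((size s1).+1 < size vs)%N by rewrite sv -!addSnnS leq_addr.
  (* Only the terms that remove one of the two equal vectors survive; they are
     opposite. *)
  rewrite (bigD1 (Ordinal i1))//= (bigD1 (Ordinal i2))/=; last first.
    by rewrite -val_eqE /= -[X in _ != X]addn0 -addn1 eqn_add2l.
  rewrite big1 ?addr0.
    rewrite {1 3}/vs !nth_cat ltnn subnn ltnNge leqnSn /= subSnn /=.
    rewrite {1 2}/vs !del_cat_ge// /vs subnn subSnn /= drop0 exprS mulN1r.
    rewrite -{1}cat1s mulNr.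
    by rewrite [X in _ - X](_ : _ = (-1) ^+ size s1 *
      'D_y (fun y0 => u y0 (s1 ++ y :: s2)) x) ?subrr//= /vs !del_cat_ge// subSnn /= drop0.
  move=> i /andP[n1 n2].
  rewrite (_ : (fun _ => _) = cst 0) ?derive_cst ?mulr0//.
  apply/funext => t; case: (ltnP i (size s1)) => [i1'|i1'].
    by rewrite /vs del_cat_lt// (Lam_alt _ _ _ _ (P_Lam us)).
  rewrite /vs del_cat_ge//.
  have : (1 < i - size s1)%N.
    move: n1 n2; rewrite -!val_eqE /=; lia.
  case: (i - size s1)%N => [//|[//|j]] _ /=.
  exact: (Lam_alt _ _ _ _ (P_Lam us)).
Qed.

Lemma P_ext_d s k u : P s k u -> P s.-1 (k + 1) (ext_d u).
Proof.
move=> us; split; first exact: Lam_ext_d us.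
move=> vs; rewrite /ext_d; apply: polynomial_fun_sum => i.
by apply: polynomial_funZ; apply: polynomial_derive; exact: P_poly us.
Qed.

Lemma ext_dD s k u v : P s k u -> P s k v ->
  ext_d (fun x vs => u x vs + v x vs) = fun x vs => ext_d u x vs + ext_d v x vs.
Proof.
move=> us vs_; apply/funext => x; apply/funext => vs.
rewrite /ext_d -big_split; apply: eq_bigr => i _ /=.
by rewrite (derive_polyD _ _ (P_poly _ us) (P_poly _ vs_)) mulrDr.
Qed.

Lemma ext_dZ s k a u : P s k u ->
  ext_d (fun x vs => a * u x vs) = fun x vs => a * ext_d u x vs.
Proof.
move=> us; apply/funext => x; apply/funext => vs.
rewrite /ext_d mulr_sumr; apply: eq_bigr => i _ /=.
by rewrite (derive_polyZ _ _ _ (P_poly _ us)) mulrCA.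
Qed.

(** The product rule, for the dependence of [u] on the point and for that of the
    vector [y - b]. *)
Lemma derive_contract s k u b x z vs : P s k u ->
  'D_z (fun y => u y ((y - b) :: vs)) x =
  'D_z (fun y => u y ((x - b) :: vs)) x + u x (z :: vs).
Proof.
move=> us; have uk := P_Lam us; have Pp := P_poly _ us.
have PF i : polynomial_fun s.+1 (fun y : 'rV[R]_d => (y 0 i - b 0 i) * u y (delta_mx 0 i :: vs)).
  exact: polynomial_shiftX.
have PG i : polynomial_fun s (fun y : 'rV[R]_d => (x 0 i - b 0 i) * u y (delta_mx 0 i :: vs)).
  exact: polynomial_funZ.
have dsum (t : nat) (F : 'I_d -> 'rV[R]_d -> R) (FP : forall i, polynomial_fun t (F i)) :
    'D_z (fun y => \sum_i F i y) x = \sum_i 'D_z (F i) x.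
  rewrite (_ : (fun _ => _) = \sum_i F i); last first.
    by apply/funext => y; rewrite fct_sumE.
  by rewrite derive_sum// => i; exact: derivable_polynomial (FP i).
rewrite (_ : (fun y => u y ((y - b) :: vs)) =
    fun y => \sum_i (y 0 i - b 0 i) * u y (delta_mx 0 i :: vs)); last first.
  by apply/funext => y; rewrite -(contractE _ _ _ uk).
rewrite [in RHS](_ : (fun y => u y ((x - b) :: vs)) =
    fun y => \sum_i (x 0 i - b 0 i) * u y (delta_mx 0 i :: vs)); last first.
  by apply/funext => y; rewrite (Lam_head_sum _ _ _ uk); apply: eq_bigr => i _; rewrite !mxE.
rewrite (dsum _ _ PF) (dsum _ _ PG) [u x _](Lam_head_sum _ _ _ uk) -big_split/=.
apply: eq_bigr => i _; rewrite (derive_polyZ _ _ _ (Pp _)).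
rewrite (_ : (fun _ => _) = fun y : 'rV[R]_d => y 0 i * u y (delta_mx 0 i :: vs) +
    (- b 0 i) * u y (delta_mx 0 i :: vs)); last first.
  by apply/funext => y; rewrite mulrDl.
rewrite (derive_polyD _ _ (polynomial_funX _ (Pp _)) (polynomial_funZ _ (Pp _))).
rewrite (derive_polyX _ _ _ (Pp _)) (derive_polyZ _ _ _ (Pp _)); ring.
Qed.

(** Since [contract b] annihilates [contract b u], Cartan's formula makes the left
    side the Lie derivative of [contract b u] along [x - b]. Each vector of the
    list contributes one copy of the form to it, as the derivative of [x - b]
    along a vector is that vector. *)
Lemma contract_ext_d_contract s k u b x vs : P s k u ->
  contract b (ext_d (contract b u)) x vs =
  'D_(x - b) (fun y => contract b u y vs) x + (size vs)%:R * contract b u x vs.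
Proof.
move=> us; have uk := P_Lam us.
rewrite {1}/contract {1}/ext_d /= big_ord_recl /= expr0 mul1r drop0; congr (_ + _).
rewrite (eq_bigr (fun=> contract b u x vs)).
  by rewrite sumr_const card_ord mulr_natl.
move=> i _; rewrite /bump /= add1n /= /contract.
rewrite (derive_contract _ _ _ _ us).
rewrite (_ : (fun _ => _) = cst 0) ?derive_cst ?add0r; last first.
  by apply/funext => y; exact: (Lam_alt y [::] _ _ uk).
rewrite (Lam_swap _ [::] _ _ _ uk) /= (Lam_front x [:: x - b] uk (ltn_ord i)).
by rewrite exprS mulN1r mulrNN mulrA -exprD addnn -mul2n exprM sqrrN !expr1n mul1r.
Qed.

End PolynomialForms.

(** * Decomposition of polynomial forms and restriction to faces *)

Section Koszul.
Variables (R : realType) (d : nat) (K : set 'rV[R]_d).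
Implicit Types (u v w : dform R d) (k : int).

Lemma P_kappa s k u : P s k u -> P s.+1 (k - 1) (kappa K u).
Proof. exact: P_contract. Qed.

Lemma PminusD s k u v : Pminus K s k u -> Pminus K s k v ->
  Pminus K s k (fun x vs => u x vs + v x vs).
Proof. by move=> [? ?] [? ?]; split; exact: PD. Qed.

Lemma PminusZ s k a u : Pminus K s k u -> Pminus K s k (fun x vs => a * u x vs).
Proof. by move=> [? ?]; split; exact: PZ. Qed.

Lemma P_Pminus s k u : P s k u -> Pminus K s.+1 k u.
Proof. by move=> us; split; [exact: PW us|exact: P_kappa]. Qed.

Lemma kappa_kappa k u : Lam k u -> kappa K (kappa K u) = @form0 R d.
Proof.
move=> uk; apply/funext => x; apply/funext => vs.
exact: (Lam_alt x [::] vs _ uk).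
Qed.

Lemma Pminus_kappa s k u : P s k u -> Pminus K s.+1 (k - 1) (kappa K u).
Proof.
move=> us; split; first exact: P_kappa.
by rewrite (kappa_kappa (P_Lam us)); exact: P0.
Qed.

(** Applying [kappa] to [w - d alpha], with [alpha = kappa w / (s + k)], gives a
    multiple of [E - (s + 1)] applied to [kappa w], where [E] is the derivative
    along [x - b]; this lowers the degree. The constant [1 / (s + k)] is the
    one for which the terms of degree [s + 1] cancel. *)
Lemma Pminus_sub_ext_d_kappa s k w : P s k w ->
  Pminus K s k (fun x vs => w x vs +
    - ((s%:Z + k)%:~R^-1 * ext_d (kappa K w) x vs)).
Proof.
move=> ws; have kw := P_kappa ws.
have := P_ext_d kw; rewrite subrK /= => dkw.
split.
  apply: PD => //; rewrite (_ : (fun _ _ => _) =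
    fun x vs => - (s%:Z + k)%:~R^-1 * ext_d (kappa K w) x vs); first exact: PZ.
  by apply/funext => x; apply/funext => vs; rewrite mulNr.
split.
  apply: Lam_contract; apply: LamD; first exact: P_Lam ws.
  rewrite (_ : (fun _ _ => _) =
    fun x vs => - (s%:Z + k)%:~R^-1 * ext_d (kappa K w) x vs).
    by apply: LamZ; exact: P_Lam dkw.
  by apply/funext => x; apply/funext => vs; rewrite mulNr.
(* The number of vectors fixes the degree [k], unless everything vanishes. *)
move=> vs; have [kE|nk] := eqVneq (size vs)%:Z (k - 1); last first.
  rewrite (_ : (fun _ => _) = fun=> 0); first exact: polynomial_fun_cst.
  apply/funext => x; rewrite /kappa /contract.
  have sk : (size ((x - barycentre K) :: vs))%:Z != k.
    by apply: contra_neq nk => <-; rewrite /= intS addrC addKr.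
  by rewrite (Lam_size _ (P_Lam ws))// (Lam_size _ (P_Lam dkw))// mulr0 oppr0 addr0.
pose n := size vs.
have kn : k = n.+1%:Z by rewrite -(subrK 1 k) -kE -(addn1 n) PoszD.
pose c : R := (s + n.+1)%:R^-1.
rewrite (_ : (fun _ => _) = fun x => (- c) * ('D_(x - barycentre K)
    (fun y => kappa K w y vs) x - s.+1%:R * kappa K w x vs)).
  by apply: polynomial_funZ; apply: polynomial_euler; exact: P_poly kw.
apply/funext => x; have := contract_ext_d_contract (barycentre K) x vs ws.
rewrite /kappa /contract => ->; rewrite kn -PoszD -/n.
have -> : (s + n.+1)%:~R^-1 = c by [].
have c0 : c * (s.+1%:R + n%:R) = 1.
  by rewrite -natrD addSnnS /c mulVf// pnatr_eq0 addnS.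
rewrite -[X in X + _ = _]mul1r -{1}c0; ring.
Qed.

End Koszul.

Section Pullback.
Variables (R : realType) (N : nat) (M : mesh R N) (F T : cell M).

Lemma inclE (x : 'rV[R]_(cdim F)) :
  incl T x = (org F - org T) *m (frm T)^T + x *m dincl F T.
Proof.
by rewrite /incl /embed /affine /dincl mulmxA -mulmxDl addrAC.
Qed.

Lemma polynomial_incl s f : polynomial_fun s f ->
  polynomial_fun s (fun x : 'rV[R]_(cdim F) => f (incl T x)).
Proof.
move: s f; apply: polynomial_fun_ind.
- by move=> s c; exact: polynomial_fun_cst.
- by move=> s f g; exact: polynomial_funD.
- move=> s i f _ fs; pose a := ((org F - org T) *m (frm T)^T) 0 i.
  rewrite (_ : (fun _ => _) = fun x : 'rV[R]_(cdim F) => a * f (incl T x) +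
      \sum_j dincl F T j i * (x 0 j * f (incl T x))).
    apply: polynomial_funD.
      by apply: polynomial_funZ; exact: polynomial_funW fs.
    by apply: polynomial_fun_sum => j; apply: polynomial_funZ; exact: polynomial_funX.
  apply/funext => x; rewrite {1}inclE mxE -/a mulrDl; congr (_ + _).
  rewrite mxE mulr_suml; apply: eq_bigr => j _; ring.
Qed.

Lemma P_pullback s k (u : dform R (cdim T)) : P s k u ->
  P s k (pullback (F := F) u).
Proof.
move=> us; have uk := P_Lam us; split=> [x|vs]; last first.
  exact: (polynomial_incl (P_poly [seq v *m dincl F T | v <- vs] us)).
rewrite /pullback; split=> [vs sk|s1 s2 a y z|s1 s2 y].
- by apply: (Lam_size _ uk); rewrite size_map.
- by rewrite !map_cat /= mulmxDl -scalemxAl (Lam_lin _ _ _ _ _ _ uk).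
- by rewrite map_cat /= (Lam_alt _ _ _ _ uk).
Qed.

(** The spaces [Pminus] of two cells are based at different barycentres; moving
    the base point changes the contraction by a constant vector, which does not
    raise the degree. *)
Lemma Pminus_pullback s k (u : dform R (cdim T)) : Pminus (body T) s k u ->
  Pminus (body F) s k (pullback (F := F) u).
Proof.
move=> [us ku]; split; first exact: P_pullback.
pose c := incl T (barycentre (body F)) - barycentre (body T).
have := PD (P_pullback ku) (PZ (-1) (P_pullback (P_contract_cst c us))).
congr (P s (k - 1) _); apply/funext => x; apply/funext => vs.
rewrite /kappa /contract /pullback /= mulN1r.
have -> : (x - barycentre (body F)) *m dincl F T =
    (-1) *: c + (incl T x - barycentre (body T)).
  rewrite /c !inclE mulmxBl.
  move: (_ *m (frm T)^T) (x *m _) (barycentre (body F) *m _) (barycentre (body T)) => a0 a1 a2 a3.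
  by apply/rowP => j; rewrite !mxE; ring.
by rewrite (Lam_lin _ [::] _ _ _ _ (P_Lam us)) /= mulN1r addrC.
Qed.

End Pullback.

(** * Compactness and measurability of cells *)

Section CellMeasure.
Variables (R : realType) (d : nat).
Local Notation row := (@row_of_tuple R d).
Local Notation mu := (lebesgue_tuple R d).

Lemma norm_coord_le (x : 'rV[R]_d) i : `|x 0 i| <= `|x|.
Proof.
have /mapP[j Hj ->] : `|x 0 i| \in [seq `|x ij.1 ij.2| | ij : 'I_1 * 'I_d].
  by apply/mapP; exists (0, i) => //=; rewrite mem_enum.
by rewrite [leRHS]/Num.norm /= mx_normrE; apply/bigmax_geP; right => /=; exists j.
Qed.

(** The product sigma-algebra on tuples contains these countably many boxes, and
    they generate the topology. *)
Definition rational_box (ab : 'rV[rat]_d * 'rV[rat]_d) : set 'rV[R]_d :=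
  [set x | forall i, ratr (ab.1 0 i) < x 0 i < ratr (ab.2 0 i)].

Lemma measurable_rational_box ab : measurable (row @^-1` rational_box ab).
Proof.
rewrite (_ : _ @^-1` _ = \bigcap_(i in [set: 'I_d])
    ((fun t => tnth t i) @^-1` `]ratr (ab.1 0 i), ratr (ab.2 0 i)[)); last first.
  apply/seteqP; split => t /=.
    by move=> H i _ /=; have := H i; rewrite mxE in_itv.
  by move=> H i; have := H i I; rewrite /= mxE in_itv.
apply: fin_bigcap_measurable; first exact: finite_finset.
move=> i _; rewrite -[X in measurable X]setTI.
by apply: measurable_tnth => //; exact: measurable_itv.
Qed.

Lemma measurable_preimage_open (O : set 'rV[R]_d) : open O ->
  measurable (row @^-1` O).
Proof.
move=> oO; pose F ab := [set t | rational_box ab `<=` O /\ rational_box ab (row t)].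
rewrite (_ : row @^-1` O = \bigcup_ab F ab); last first.
  apply/seteqP; split => [t /= Ot|t [ab _ [sO]]]; last exact: sO.
  have /nbhs_ballP[e /= e0 sO] : nbhs (row t) O by apply: open_nbhs_nbhs.
  have qa i : exists q : rat, ratr q \in `](row t 0 i - e), (row t 0 i)[.
    by apply: rat_in_itvoo; rewrite ltrBlDr ltrDl.
  have qb i : exists q : rat, ratr q \in `](row t 0 i), (row t 0 i + e)[.
    by apply: rat_in_itvoo; rewrite ltrDl.
  have [a aP] := choice qa; have [b bP] := choice qb.
  exists (\row_i a i, \row_i b i) => //; split.
    move=> y yab; apply: sO; split=> // i j; rewrite (ord1 i).
    have := yab j; have := aP j; have := bP j; rewrite /= !mxE !in_itv /=.
    move=> /andP[b1 b2] /andP[a1 a2] /andP[y1 y2].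
    rewrite /ball /= ltr_norml; apply/andP; split; lra.
  move=> i; have := aP i; have := bP i; rewrite /= !mxE !in_itv /=.
  by move=> /andP[-> _] /andP[_ ->].
apply: countable_bigcupT_measurable => // ab.
have [sO|nO] := pselect (rational_box ab `<=` O).
  rewrite (_ : F ab = row @^-1` rational_box ab); first exact: measurable_rational_box.
  by apply/seteqP; split => [t []|t].
rewrite (_ : F ab = set0) //; by apply/seteqP; split => [t []|t].
Qed.

Lemma measurable_preimage_closed (K : set 'rV[R]_d) : closed K ->
  measurable (row @^-1` K).
Proof.
move=> /closed_openC/measurable_preimage_open/measurableC.
by rewrite -preimage_setC setCK.
Qed.

Lemma compact_unit_ball : compact (@unit_ball R d).
Proof.
apply: bounded_closed_compact.
  exists 1; split; first exact: num_real.
  move=> M M1 x xB /=; apply: le_trans (ltW M1).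
  rewrite /Num.norm /= mx_normrE; apply/bigmax_leP; split => //= -[i j] _ /=.
  rewrite (ord1 i) -[leRHS]sqrtr1 -sqrtr_sqr ler_sqrt//.
  apply: le_trans xB; rewrite (bigD1 j)//= lerDl; apply: sumr_ge0 => l _.
  exact: sqr_ge0.
have ps : polynomial_fun 2 (fun x : 'rV[R]_d => \sum_i x 0 i ^+ 2).
  apply: polynomial_fun_sum => i.
  rewrite (_ : (fun _ => _) = fun x : 'rV[R]_d => x 0 i * (x 0 i * 1)).
    by do 2 apply: polynomial_funX; exact: polynomial_fun_cst.
  by apply/funext => x; rewrite mulr1.
rewrite (_ : @unit_ball R d = (fun x : 'rV[R]_d => \sum_i x 0 i ^+ 2) @^-1` [set y | y <= 1])//.
apply: closed_comp; last exact: closed_le.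
by move=> x _; exact: (@continuous_polynomial _ _ _ _ ps x).
Qed.

(** Cells are given as sets without any measurability; compactness provides it,
    as well as finiteness of the measure. *)
Lemma compact_bilipschitz_ball (K : set 'rV[R]_d) : bilipschitz_ball K -> compact K.
Proof.
move=> [f [C [<- fC]]]; apply: continuous_compact; last exact: compact_unit_ball.
apply/subspace_continuousP => x Bx; apply/cvgrPdist_le => e e0.
have C1 : 0 < `|C| + 1 by rewrite ltr_wpDl.
near=> y; have By : unit_ball y by near: y; exact: withinT.
have [+ _] := fC _ _ Bx By => /le_trans; apply.
apply: (@le_trans _ _ ((`|C| + 1) * `|x - y|)).
  by apply: ler_wpM2r => //; rewrite (le_trans (ler_norm C))// lerDl.
rewrite mulrC -ler_pdivlMr//; near: y.
apply: (@cvg_within _ (nbhs x) _ (@unit_ball R d)).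
have /cvgrPdist_le := @cvg_id _ (nbhs x); apply; exact: divr_gt0.
Unshelve. all: by end_near. Qed.

End CellMeasure.

(** * Integration of polynomials and square integrable forms *)

Section CellIntegrals.
Variables (R : realType) (d : nat).
Local Notation row := (@row_of_tuple R d).
Local Notation mu := (lebesgue_tuple R d).

Definition tuple_box n (C : R) : set (n.-tuple (measurableTypeR R)) :=
  [set t | forall i, (tnth t i : R) \in `[- C, C]].

Lemma measurable_tuple_box n C : measurable (@tuple_box n C).
Proof.
rewrite (_ : @tuple_box n C = \bigcap_(i in [set: 'I_n])
    ((fun t => tnth t i) @^-1` `[- C, C])); last first.
  by apply/seteqP; split => t /= H i; [move=> _|]; apply: H.
apply: fin_bigcap_measurable; first exact: finite_finset.
move=> i _; rewrite -[X in measurable X]setTI.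
by apply: measurable_tnth => //; exact: measurable_itv.
Qed.

(** The measure of a box is computed one coordinate at a time, as the measure on
    tuples is an iterated product. *)
Lemma lebesgue_tuple_box n C : (lebesgue_tuple R n (@tuple_box n C) < +oo)%E.
Proof.
elim: n => [|n IH].
  by rewrite /= diracE; case: (_ \in _) => /=; rewrite ltry.
rewrite /= /cons_measure /pushforward.
rewrite (_ : _ @^-1` _ = `[- C, C] `*` @tuple_box n C); last first.
  apply/seteqP; split => -[x t] /=.
    move=> H; split; first by have := H ord0; rewrite (tnth_nth x)/=.
    by move=> i; have := H (lift ord0 i); rewrite !(tnth_nth x)/=.
  move=> [xC tC] i; rewrite (tnth_nth x) /=.
  case: (unliftP ord0 i) => [j ->|->] //=.
  by have := tC j; rewrite (tnth_nth x).
rewrite product_measure1E; [|exact: measurable_itv|exact: measurable_tuple_box].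
rewrite lte_mul_pinfty//.
by have /= -> := @lebesgue_measure_itv R `[- C, C]; case: ifP.
Qed.

Lemma compact_measure_fin (K : set 'rV[R]_d) : compact K ->
  (mu (row @^-1` K) < +oo)%E.
Proof.
move=> cK; have [C [_ HC]] := compact_bounded cK.
apply: le_lt_trans (lebesgue_tuple_box d (C + 1)).
have mK := measurable_preimage_closed (compact_closed (@norm_hausdorff _ _) cK).
apply: le_measure; rewrite ?inE//; first exact: measurable_tuple_box.
move=> t /= /(HC (C + 1)) /= H i; rewrite in_itv /= -ler_norml.
have := norm_coord_le (row t) i; rewrite mxE => /le_trans; apply; apply: H.
by rewrite ltrDl.
Qed.

Variable K : set 'rV[R]_d.
Hypothesis cK : compact K.

Let mK : measurable (row @^-1` K).
Proof. exact: measurable_preimage_closed (compact_closed (@norm_hausdorff _ _) cK). Qed.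

Lemma measurable_polynomial s f : polynomial_fun s f ->
  measurable_fun (row @^-1` K) (f \o row : _ -> measurableTypeR R).
Proof.
move: s f; apply: (@polynomial_fun_ind R d
  (fun _ f => measurable_fun (row @^-1` K) (f \o row : _ -> measurableTypeR R))).
- by move=> _ c; exact: measurable_cst.
- by move=> _ f g; exact: measurable_funD.
- move=> _ i f _ mf; apply: measurable_funM => //.
  rewrite (_ : (fun _ => _) = fun t => tnth t i); last first.
    by apply/funext => t; rewrite mxE.
  by apply: measurable_funTS; exact: measurable_tnth.
Qed.

Lemma bounded_polynomial s f : polynomial_fun s f ->
  [bounded f (row t) | t in row @^-1` K].
Proof.
move=> fs; have : compact (f @` K).
  apply: continuous_compact => //; apply: continuous_subspaceT.
  exact: continuous_polynomial fs.
move=> /compact_bounded[C [Cr HC]]; exists C; split => // M /HC H t /= Kt.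
by apply: H; exists (row t).
Qed.

Definition integrable_on (f : 'rV[R]_d -> R) : Prop :=
  mu.-integrable (row @^-1` K) (EFin \o (f \o row)).

Lemma integrable_on_polynomial s f : polynomial_fun s f -> integrable_on f.
Proof.
move=> fs; apply: measurable_bounded_integrable => //.
- exact: compact_measure_fin.
- exact: measurable_polynomial fs.
- exact: bounded_polynomial fs.
Qed.

(** On a set of finite measure, a square integrable function is integrable, and
    polynomials are bounded. *)
Lemma integrable_on_L2M s u vs f : L2 K u -> polynomial_fun s f ->
  integrable_on (fun x => u x vs * f x).
Proof.
move=> /(_ vs)[mu_ iu] fs.
have i1 : integrable_on (u ^~ vs).
  apply: (@le_integrable _ _ _ _ _ mK _
    ((EFin \o ((fun=> 1%R) \o row)) \+ (fun t => ((u (row t) vs) ^+ 2)%:E))%E).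
  - by apply/measurable_EFinP.
  - move=> t _; rewrite /= lee_fin ler_norml.
    have H : 0 <= 1 + u (row t) vs ^+ 2 by rewrite addr_ge0// sqr_ge0.
    rewrite (ger0_norm H); apply/andP; split; nra.
  - apply: integrableD => //.
    by have := integrable_on_polynomial (@polynomial_fun_cst R d 0 1%R).
have := integrableMl mK i1 (measurable_polynomial fs) (bounded_polynomial fs).
by [].
Qed.

Lemma integrable_on_polyM s t f g : polynomial_fun s f -> polynomial_fun t g ->
  integrable_on (fun x => f x * g x).
Proof.
move=> fs gt; have := integrableMl mK (integrable_on_polynomial fs)
  (measurable_polynomial gt) (bounded_polynomial gt).
by [].
Qed.

Lemma integrable_onD f g : integrable_on f -> integrable_on g -> integrable_on (fun x => f x + g x).
Proof. by move=> fi gi; exact: (integrableD mK fi gi). Qed.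

Lemma integrable_onZ a f : integrable_on f -> integrable_on (fun x => a * f x).
Proof. by move=> fi; exact: (integrableZl mK a fi). Qed.

Lemma integrable_on_sum (I : Type) (r : seq I) (F : I -> 'rV[R]_d -> R) :
  (forall i, integrable_on (F i)) -> integrable_on (fun x => \sum_(i <- r) F i x).
Proof.
move=> iF; elim: r => [|i r IH].
  rewrite (_ : (fun _ => _) = fun=> 0%R).
    by have := integrable_on_polynomial (@polynomial_fun_cst R d 0 0).
  by apply/funext => x; rewrite big_nil.
rewrite (_ : (fun _ => _) = fun x => F i x + \sum_(i <- r) F i x).
  exact: integrable_onD.
by apply/funext => x; rewrite big_cons.
Qed.

Lemma int_funD f g : integrable_on f -> integrable_on g ->
  int_fun K (fun x => f x + g x) = int_fun K f + int_fun K g.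
Proof. by move=> fi gi; exact: (RintegralD mK fi gi). Qed.

Lemma int_funZ a f : integrable_on f -> int_fun K (fun x => a * f x) = a * int_fun K f.
Proof. by move=> fi; exact: (RintegralZl a mK fi). Qed.

Lemma int_fun_ge0 f : (forall x, 0 <= f x) -> 0 <= int_fun K f.
Proof. by move=> f0; apply: Rintegral_ge0. Qed.

Lemma integrable_on_wedge s k u w vs : L2 K u -> P s k w ->
  integrable_on (fun x => wedge u w x vs).
Proof.
move=> uK ws; apply: integrable_on_sum => m.
rewrite (_ : (fun _ => _) = fun x => (-1) ^+ inversions m *
  (u x (mask m vs) * w x (mask (map negb m) vs))); last first.
  by apply/funext => x; rewrite mulrA.
by apply: integrable_onZ; apply: integrable_on_L2M uK _; exact: P_poly ws.
Qed.

Lemma int_form_wedgeD s t k l u v w : L2 K u -> P s k v -> P t l w ->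
  int_form K (wedge u (fun x vs => v x vs + w x vs)) =
  int_form K (wedge u v) + int_form K (wedge u w).
Proof.
move=> uK vs ws; rewrite /int_form -int_funD; last 2 first.
- exact: integrable_on_wedge vs.
- exact: integrable_on_wedge ws.
congr int_fun; apply/funext => x.
by rewrite /wedge -big_split; apply: eq_bigr => m _ /=; rewrite mulrDr.
Qed.

Lemma int_form_wedgeZ s k a u v : L2 K u -> P s k v ->
  int_form K (wedge u (fun x vs => a * v x vs)) = a * int_form K (wedge u v).
Proof.
move=> uK vs; rewrite /int_form -int_funZ; last exact: integrable_on_wedge vs.
congr int_fun; apply/funext => x.
by rewrite /wedge mulr_sumr; apply: eq_bigr => m _ /=; rewrite mulrCA.
Qed.

End CellIntegrals.

(** * Projection onto polynomial forms *)

Section SemidefiniteProjection.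
Variables (R : realFieldType) (n : nat) (B : 'rV[R]_n -> 'rV[R]_n -> R).
Hypothesis Blin : forall a u v w, B (a *: u + v) w = a * B u w + B v w.
Hypothesis Bsym : forall u v, B u v = B v u.
Hypothesis Bpos : forall u, 0 <= B u u.

Let B0 w : B 0 w = 0.
Proof.
have := Blin (-1) 0 0 w; rewrite scaler0 addr0 => ->.
by rewrite mulN1r addNr.
Qed.

Let Blinr a u v w : B w (a *: u + v) = a * B w u + B w v.
Proof. by rewrite Bsym Blin !(Bsym w). Qed.

(** If [B u e] were nonzero, the quadratic form of [B] would be negative at a
    suitable combination of [u] and [e]. *)
Lemma semidefinite_radical u e : B e e = 0 -> B u e = 0.
Proof.
move=> e0; apply/eqP/negPn/negP => b0.
have := Bpos (- (B u u + 1) / (2 * B u e) *: e + u).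
rewrite Blin !Blinr e0 mulr0 add0r [B e u]Bsym.
set b := B u e in b0 *; set a := B u u.
rewrite (_ : _ + _ = - 1) ?ler0N1// ?oppr_ge0 ?ler10//.
by field; rewrite b0 //= pnatr_eq0.
Qed.

(** Induction on the number of coordinates that may be nonzero on [S]: fixing one
    more coordinate to zero gives a hyperplane of [S] or [S] itself. In the first
    case the projection gets one more component, along a vector [f] of [S] that
    is orthogonal to the hyperplane. If [f] has norm zero it is orthogonal to
    everything, and this component may be arbitrary; division by zero then picks
    zero. *)
Lemma semidefinite_projection (S : set 'rV[R]_n) : S 0 ->
  (forall a u v, S u -> S v -> S (a *: u + v)) ->
  forall u, exists2 q, S q & forall p, S p -> B u p = B q p.
Proof.
have : forall p, S p -> (forall j, j \in enum 'I_n -> p 0 j = 0) -> p = 0.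
  by move=> p _ p0; apply/rowP => j; rewrite mxE p0// mem_enum.
elim: (enum 'I_n) S => [|j J IH] S SJ S0 SL u.
  by exists 0 => // p Sp; rewrite (SJ p Sp)// Bsym !B0.
have SJ0 : forall p, (S p /\ p 0 j = 0) -> (forall i, i \in J -> p 0 i = 0) -> p = 0.
  move=> p [Sp pj] pJ; apply: SJ => // i; rewrite in_cons.
  by move=> /orP[/eqP ->//|]; exact: pJ.
have {}IH := IH [set p | S p /\ p 0 j = 0] SJ0 (conj S0 (mxE _ _ _ _)).
have {}IH : forall u, exists2 q, (S q /\ q 0 j = 0) &
    forall p, S p /\ p 0 j = 0 -> B u p = B q p.
  apply: IH => a v w [Sv vj] [Sw wj]; split; first exact: SL.
  by rewrite !mxE vj wj mulr0 addr0.
have [q0 [Sq0 q0j] q0P] := IH u.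
have [[e Se ej]|noe] := pselect (exists2 e, S e & e 0 j != 0); last first.
  exists q0 => // p Sp; apply: q0P; split=> //.
  by apply/eqP/negPn/negP => pj; apply: noe; exists p.
have [e0 [Se0 e0j] e0P] := IH e.
pose f := -1 *: e0 + e.
have Sf : S f by exact: SL.
have fj : f 0 j != 0 by rewrite !mxE e0j mulr0 add0r.
have fP p : S p /\ p 0 j = 0 -> B f p = 0.
  by move=> Sp; rewrite Blin (e0P _ Sp) mulN1r addNr.
clearbody f; pose t := B u f / B f f.
have tE : t * B f f = B u f.
  have [ff0|ff] := eqVneq (B f f) 0; last by rewrite divfK.
  by rewrite ff0 mulr0 (semidefinite_radical _ ff0).
exists (t *: f + q0) => [|p Sp]; first exact: SL.
have [p0 [Sp0 ->]] : exists p0, (S p0 /\ p0 0 j = 0) /\ p = (p 0 j / f 0 j) *: f + p0.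
  exists (- (p 0 j / f 0 j) *: f + p); split.
    by split; [exact: SL|rewrite 2!mxE mulNr divfK// addNr].
  by rewrite addrA -scalerDl subrr scale0r add0r.
rewrite Blin !Blinr (q0P _ Sp0) (fP _ Sp0) [B q0 f]Bsym (fP q0)// -tE; ring.
Qed.

End SemidefiniteProjection.

Section PolynomialProjection.
Variables (R : realType) (d : nat) (K : set 'rV[R]_d).
Hypothesis cK : compact K.
Implicit Types (u v w : dform R d) (k : int).

Lemma polynomial_fun_span s : exists n (e : 'I_n -> 'rV[R]_d -> R),
  (forall i, polynomial_fun s (e i)) /\
  forall f, polynomial_fun s f -> exists c : 'I_n -> R,
    forall x, f x = \sum_i c i * e i x.
Proof.
pose I : finType := mpoly.bmultinom d s.+1.
pose m (i : 'I_#|I|) : mpoly.multinom d := \val (enum_val i : I).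
exists #|I|, (fun i x => 1 * \prod_j x 0 j ^+ m i j); split.
  move=> i; apply: polynomial_fun_monomial.
  exact: (mpoly.bmdeg (enum_val i : I)).
move=> f [p [ps fE]]; exists (fun i => mpoly.mcoeff (m i) p) => x.
have sp : (mpoly.msize p <= s.+1)%N.
  rewrite mpoly.msizeE; apply/bigmax_leqP_seq => i ip _.
  by rewrite ltnS; apply: ps; rewrite -mpoly.mcoeff_msupp.
rewrite fE [X in mpoly.meval _ X](mpoly.mpolywE sp) raddf_sum /=.
rewrite (reindex_onto (@enum_val I predT) enum_rank)/=; last first.
  by move=> i _; rewrite enum_rankK.
apply: eq_big => [i|i _]; first by rewrite enum_valK eqxx.
by rewrite mpoly.mevalZ mpoly.mevalX mul1r.
Qed.

(** Only the components of a form on the coordinate subspaces enter the scalar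
    product, and for polynomial forms of bounded degree these are determined by
    finitely many coefficients: this reduces the existence of the projection to
    a subspace of a space of row vectors. *)
Lemma L2_projection_exists s k r l u : P s k u ->
  exists q, P r l q /\ forall p, P r l p -> ip K u p = ip K q p.
Proof.
move=> us; set t := maxn s r.
have [n [e [eP eS]]] := polynomial_fun_span t.
pose J : finType := ({set 'I_d} * 'I_n)%type.
pose comp (c : 'rV[R]_#|J|) (A : {set 'I_d}) (x : 'rV[R]_d) : R :=
  \sum_i c 0 (enum_rank ((A, i) : J)) * e i x.
have compP c A : polynomial_fun t (comp c A).
  by apply: polynomial_fun_sum => i; exact: polynomial_funZ.
have compL a c c' A x : comp (a *: c + c') A x = a * comp c A x + comp c' A x.
  rewrite mulr_sumr -big_split; apply: eq_bigr => i _ /=.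
  by rewrite !mxE mulrDl mulrA.
pose B c c' := int_fun K (fun x => \sum_A comp c A x * comp c' A x).
have Bi c c' : integrable_on K (fun x => \sum_A comp c A x * comp c' A x).
  apply: integrable_on_sum => // A; apply: (@integrable_on_polyM _ _ _ cK t t); exact: compP.
have BL a c c' c0 : B (a *: c + c') c0 = a * B c c0 + B c' c0.
  rewrite /B -int_funZ// -int_funD//; last exact: integrable_onZ.
  congr int_fun; apply/funext => x; rewrite mulr_sumr -big_split.
  by apply: eq_bigr => A _ /=; rewrite compL mulrDl mulrA.
have Bs c c' : B c c' = B c' c.
  by congr int_fun; apply/funext => x; apply: eq_bigr => A _; rewrite mulrC.
have Bp c : 0 <= B c c.
  by apply: int_fun_ge0 => x; apply: sumr_ge0 => A _; rewrite -expr2 sqr_ge0.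
pose repr (p : dform R d) c := forall A x, p x (vbasis_of R A) = comp c A x.
have ipE p p' c c' : repr p c -> repr p' c' -> ip K p p' = B c c'.
  move=> pc p'c'; congr int_fun; apply/funext => x; rewrite /dot.
  by apply: eq_bigr => A _; rewrite pc p'c'.
have reprE s' k' p : (s' <= t)%N -> P s' k' p -> exists c, repr p c.
  move=> s't ps; have /choice[c cP] : forall A : {set 'I_d}, exists c : 'I_n -> R,
      forall x, p x (vbasis_of R A) = \sum_i c i * e i x.
    move=> A; apply: eS; exact: polynomial_funW (P_poly (vbasis_of R A) ps).
  exists (\row_j c (enum_val j).1 (enum_val j).2) => A x.
  by rewrite cP; apply: eq_bigr => i _; rewrite mxE enum_rankK.
have [cu cuP] := reprE _ _ _ (leq_maxl s r) us.
have [|a c c' [p [pr pc]] [p' [pr' pc']]|c [q [qr qc]] cP] :=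
    @semidefinite_projection _ _ B BL Bs Bp [set c | exists p, P r l p /\ repr p c] _ _ cu.
- exists (fun _ _ => 0); split; first exact: P0.
  by move=> A x; rewrite /comp big1// => i _; rewrite mxE mul0r.
- exists (fun x vs => a * p x vs + p' x vs); split; first by apply: PD => //; exact: PZ.
  by move=> A x; rewrite compL pc pc'.
exists q; split=> // p pr; have [cp cpP] := reprE _ _ _ (leq_maxr s r) pr.
by rewrite (ipE _ _ _ _ cuP cpP) (ipE _ _ _ _ qc cpP) cP//; exists p.
Qed.

Lemma L2proj_P s k r l u : P s k u -> P r l (L2proj K (@P R d r l) u).
Proof. by move=> /(L2_projection_exists r l)/getPex[]. Qed.

Lemma ip_L2proj s k r l u p : P s k u -> P r l p ->
  ip K (L2proj K (@P R d r l) u) p = ip K u p.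
Proof. by move=> /(L2_projection_exists r l)/getPex[_ H] pr; rewrite H. Qed.

End PolynomialProjection.

(** * The recursive procedure *)

(** The forms of the introduction as expressions: [potential_expr] is [alpha],
    with [d alpha] equal to the input up to [P^r_-]; [corrector_expr] is
    [gamma]. *)
Definition potential_expr (r : nat) (l : int) : form_expr :=
  Scale (SInv (Const (r%:Z + l)%:~R)) (Koszul Input).

Definition corrector_expr (r : nat) (l : int) : form_expr :=
  Add (potential_expr r l)
    (Scale (Const (-1)) (Proj false r (l - 1) (potential_expr r l))).

(** The sign is the one of the formula of Stokes for forms of degree [k]. *)
Definition moment_step (r k d : nat) : step :=
  let l := d%:Z - k%:Z in
  Step [:: (Const 1, Add Input (Scale (Const (-1)) (Der (corrector_expr r l))))]
       [:: (Const ((-1) ^+ k), corrector_expr r l, Proj false r (l - 1) Input)].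

Section OneCell.
Variables (R : realType) (d : nat) (K : set 'rV[R]_d).
Hypothesis cK : compact K.
Implicit Types (u v w : dform R d) (k l : int).

Lemma ip_sub s t k l u v p : P s k u -> P s k v -> P t l p ->
  ip K (fun x vs => u x vs + -1 * v x vs) p = ip K u p - ip K v p.
Proof.
move=> us vs_ pt; rewrite /ip -[X in _ = _ + X]mulN1r.
have ii w : P s k w -> integrable_on K (dot w p).
  move=> ws; apply: integrable_on_sum => // A.
  exact: (integrable_on_polyM cK (P_poly _ ws) (P_poly _ pt)).
rewrite -(int_funZ cK _ (ii v vs_)) -(int_funD cK (ii u us) (integrable_onZ cK _ (ii v vs_))).
congr int_fun; apply/funext => x; rewrite /dot mulr_sumr -big_split.
by apply: eq_bigr => A _ /=; ring.
Qed.

Lemma U_sub_L2proj r k u : Pminus K r.+1 k u ->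
  U K r k (fun x vs => u x vs + -1 * L2proj K (@P R d r k) u x vs).
Proof.
move=> uK; have [ur _] := uK; have qr := L2proj_P cK r k ur.
split; first by apply: PminusD => //; apply: PminusZ; exact: P_Pminus.
move=> p pr; rewrite (ip_sub ur (PW (leqnSn r) qr) pr).
by rewrite (ip_L2proj cK ur pr) subrr.
Qed.

Lemma eval_potential r l w :
  eval_form K w (potential_expr r l) =
  fun x vs => (r%:Z + l)%:~R^-1 * kappa K w x vs.
Proof. by rewrite /= ratr_int. Qed.

Lemma eval_corrector r l w (a := eval_form K w (potential_expr r l)) :
  eval_form K w (corrector_expr r l) =
  fun x vs => a x vs + -1 * L2proj K (@P R d r (l - 1)) a x vs.
Proof. by rewrite /corrector_expr /= rmorphN1. Qed.

Lemma Pminus_potential r l w : P r l w ->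
  Pminus K r.+1 (l - 1) (eval_form K w (potential_expr r l)).
Proof.
by move=> wr; rewrite eval_potential; apply: PminusZ; exact: Pminus_kappa.
Qed.

Lemma U_corrector r l w : P r l w ->
  U K r (l - 1) (eval_form K w (corrector_expr r l)).
Proof.
move=> wr; rewrite eval_corrector; apply: U_sub_L2proj; exact: Pminus_potential.
Qed.

(** The corrector is the potential minus an element [q] of [P^r]. The derivative
    of the potential is handled by the algebraic decomposition, and that of [q]
    has degree at most [r - 1], so that [kappa] maps it into [P^r]. *)
Lemma Pminus_local r l w : (0 < r)%N -> P r l w ->
  Pminus K r l (fun x vs => w x vs +
    -1 * ext_d (eval_form K w (corrector_expr r l)) x vs).
Proof.
move=> r0 wr; have [ar _] := Pminus_potential wr.
have qr := L2proj_P cK r (l - 1) ar.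
rewrite eval_corrector (ext_dD ar (PZ (-1) (PW (leqnSn r) qr))).
rewrite (ext_dZ _ (PW (leqnSn r) qr)) eval_potential (ext_dZ _ (P_kappa K wr)).
have := P_Pminus K (P_ext_d qr); rewrite subrK prednK// => dq.
have := PminusD (Pminus_sub_ext_d_kappa K wr) dq.
congr Pminus; apply/funext => x; apply/funext => vs.
rewrite eval_potential; ring.
Qed.

Lemma int_fun_cst (c : R) : int_fun K (fun=> c) = c * int_fun K (fun=> 1).
Proof.
rewrite -(int_funZ cK c (integrable_on_polynomial cK (polynomial_fun_cst d 0 1))).
by congr int_fun; apply/funext => x; rewrite mulr1.
Qed.

Lemma int_form_wedge0 u w : (forall x vs, w x vs = 0) -> int_form K (wedge u w) = 0.
Proof.
move=> w0; rewrite /int_form (_ : (fun _ => _) = fun=> 0).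
  by rewrite int_fun_cst mul0r.
by apply/funext => x; rewrite /wedge big1// => m _; rewrite w0 mulr0.
Qed.

End OneCell.

Lemma dim0_polynomial (R : realType) s (f : 'rV[R]_0 -> R) : polynomial_fun s f.
Proof.
rewrite (_ : f = fun=> f 0); first exact: polynomial_fun_cst.
by apply/funext => x; rewrite (thinmx0 x).
Qed.

Lemma dim0_vbasis (R : realType) (A : {set 'I_0}) : vbasis_of R A = [::].
Proof.
rewrite /vbasis_of; case: (enum A) => //= -[i i0] s.
by have := i0; rewrite ltn0.
Qed.

(** On a point, either the measure vanishes or a form of norm zero vanishes. *)
Lemma dim0_int_wedge (R : realType) (K : set 'rV[R]_0) (t b : dform R 0) :
  compact K -> ip K b b = 0 -> int_form K (wedge t b) = 0.
Proof.
move=> cK bb.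
have E (f : 'rV[R]_0 -> R) : int_fun K f = f 0 * int_fun K (fun=> 1).
  rewrite -(int_fun_cst cK); congr int_fun; apply/funext => x.
  by rewrite (thinmx0 x).
move: bb; rewrite /ip E => /eqP; rewrite mulf_eq0 => /orP[b0|/eqP m0]; last first.
  by rewrite /int_form E m0 mulr0.
have {}b0 : b 0 [::] = 0.
  move: b0; rewrite /dot psumr_eq0; last by move=> A _; rewrite -expr2 sqr_ge0.
  move=> /allP/(_ (finset.set0 : {set _}) (mem_index_enum _)); rewrite implyTb dim0_vbasis.
  by rewrite mulf_eq0 orbb => /eqP.
rewrite /int_form E dim0_vbasis /wedge big1 ?mul0r// => m _.
by rewrite [m]tuple0 /= b0 mulr0.
Qed.

(** * Vanishing moments of the elements of [B] *)

Section CellTypes.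
Variables (R : realType) (d : nat) (K : set 'rV[R]_d).
Hypothesis cK : compact K.
Implicit Types (u v w : dform R d) (k l : int).

(** The difference of [a] and its projection is in [U K r (d - k)], against which
    elements of [B] have zero moment. Points are treated apart, as there [B]
    imposes no equation: all functions are then polynomials of degree at most
    [r], so that this difference is orthogonal to itself. *)
Lemma int_wedge_L2proj r k u a : L2 K u -> B K r k u ->
  Pminus K r.+1 (d%:Z - k) a ->
  int_form K (wedge u a) =
  int_form K (wedge u (L2proj K (@P R d r (d%:Z - k)) a)).
Proof.
move=> uK uB aP; have [ar _] := aP; have qr := L2proj_P cK r (d%:Z - k) ar.
set q := L2proj _ _ _ in qr *.
have qr1 := PW (leqnSn r) qr.
pose b : dform R d := fun x vs => a x vs + -1 * q x vs.
have bU : U K r (d%:Z - k) b by exact: U_sub_L2proj.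
suff b0 : int_form K (wedge u b) = 0.
  have := int_form_wedgeD cK uK ar (PZ (-1) qr1); rewrite -/b b0.
  rewrite (int_form_wedgeZ cK _ uK qr1) mulN1r => /eqP.
  by rewrite eq_sym subr_eq0 => /eqP.
case: d K cK a u q b uK uB aP ar qr qr1 bU =>
    [|e] K' cK' a' u' q b uK uB aP ar qr qr1 bU.
  apply: (dim0_int_wedge _ cK'); have [_ bO] := bU; apply: bO; split.
    by case: bU => [[[]]].
  by move=> vs; exact: dim0_polynomial.
by have [_ [fg [a1 [b1 [v1 [_ _ _ _ [_ _ bO _]]]]]]] := uB; exact: bO.
Qed.

(** An equation of [B] in positive dimension. On a point, [a] has negative degree
    and vanishes. *)
Lemma int_wedge_weak_d r (k : nat) u a : B K r k u -> U K r (d%:Z - k%:Z - 1) a ->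
  int_form K (wedge (weak_d K k u) a) = 0.
Proof.
case: d K cK u a => [|e] K' cK' u a uB aU.
  apply: int_form_wedge0 => // x vs; have [[[aL _] _] _] := aU.
  by apply: (Lam_size _ aL); lia.
by have [_ [fg [a1 [b1 [v1 [_ _ _ _ [_ aO _ _]]]]]]] := uB; exact: aO.
Qed.

End CellTypes.

(** * Induction on the faces *)

Lemma In_flatten (A : Type) (ss : seq (seq A)) x :
  List.In x (flatten ss) -> exists2 s, List.In s ss & List.In x s.
Proof.
elim: ss => //= s ss IH xss; have [xs|/IH[t ts xt]] := List.in_app_or _ _ _ xss.
  by exists s => //; left.
by exists t => //; right.
Qed.

Lemma In_map (A A' : Type) (f : A -> A') (s : seq A) y :
  List.In y (map f s) -> exists2 x, f x = y & List.In x s.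
Proof.
elim: s => //= x s IH [<-|/IH[z zy zs]]; first by exists x => //; left.
by exists z => //; right.
Qed.

Lemma In_mem (A : eqType) (s : seq A) x : List.In x s -> x \in s.
Proof.
elim: s => //= y s IH [->|/IH xs]; first exact: mem_head.
by rewrite in_cons xs orbT.
Qed.

Section Induction.
Variables (R : realType) (N : nat) (M : mesh R N) (r k : nat).
Hypothesis r0 : (0 < r)%N.
Implicit Types (T F : cell M).

Let Q := moment_step r k.

Lemma compact_body T : compact (body T).
Proof. by apply: compact_bilipschitz_ball; exact: body_ball. Qed.

Lemma face_refl T : face T T. Proof. exact/asboolP. Qed.

Lemma face_trans T F c : face F T -> face c F -> face c T.
Proof. by move=> /asboolP FT /asboolP cF; apply/asboolP => x /cF/FT. Qed.

Lemma facet_face T F : facet F T -> face F T.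
Proof. by case/andP. Qed.

(** The corrector has degree [l - 1] on [T]; this is the degree of a test form on a
    facet. *)
Lemma facet_degree T F : facet F T ->
  (cdim T)%:Z - k%:Z - 1 = (cdim F)%:Z - k%:Z.
Proof. by case/andP => _ /eqP <-; lia. Qed.

Definition corrector T (w : dform R (cdim T)) : dform R (cdim T) :=
  eval_form (body T) w (corrector_expr r ((cdim T)%:Z - k%:Z)).

Definition facet_form T F (w : dform R (cdim T)) : dform R (cdim F) :=
  L2proj (body F) (@P R _ r ((cdim F)%:Z - k%:Z)) (pullback (corrector w)).

Definition local_form T (w : dform R (cdim T)) : dform R (cdim T) :=
  fun x vs => w x vs + -1 * ext_d (corrector w) x vs.

Arguments facet_form {T} F w _ _.

Lemma Pminus_facet T F (w : dform R (cdim T)) : facet F T ->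
  P r ((cdim T)%:Z - k%:Z) w ->
  Pminus (body F) r.+1 ((cdim F)%:Z - k%:Z) (pullback (F := F) (corrector w)).
Proof.
move=> FT wr; rewrite -(facet_degree FT); apply: Pminus_pullback.
by have [] := U_corrector (@compact_body T) wr.
Qed.

Lemma P_facet_form T F (w : dform R (cdim T)) : facet F T ->
  P r ((cdim T)%:Z - k%:Z) w -> P r ((cdim F)%:Z - k%:Z) (facet_form F w).
Proof.
move=> FT /(Pminus_facet FT)[ar _]; exact: (L2proj_P (@compact_body F) _ _ ar).
Qed.

Lemma run_rec_step (S : nat -> step) n T (w : dform R (cdim T)) c1 e1 c2 e2 e3 :
  S (cdim T) = Step [:: (c1, e1)] [:: (c2, e2, e3)] ->
  run_rec S n w =
  (eval_scal (body T) w c1,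
   existT (fun c => dform R (cdim c)) T (eval_form (body T) w e1)) ::
  if n is n'.+1 then flatten
    [seq [seq (incidence F T * eval_scal (body T) w c2 * q.1, q.2)
            | q <- run_rec S n' (eval_form (body F)
                (pullback (F := F) (eval_form (body T) w e2)) e3)]
       | F <- enum [pred F | facet F T]]
  else [::].
Proof. by move=> E; case: n => [|n] /=; rewrite E //= cats0. Qed.

Lemma eval_local T (w : dform R (cdim T)) e :
  eval_form (body T) w (Add Input (Scale (Const (-1)) (Der e))) =
  fun x vs => w x vs + -1 * ext_d (eval_form (body T) w e) x vs.
Proof. by rewrite /= rmorphN1. Qed.

Lemma run_recE n T (w : dform R (cdim T)) :
  run_rec Q n w = (1, existT (fun c => dform R (cdim c)) T (local_form w)) ::
  if n is n'.+1 then flatten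
    [seq [seq ((incidence F T * (-1) ^+ k) * q.1, q.2)
            | q <- run_rec Q n' (facet_form F w)]
       | F <- enum [pred F | facet F T]]
  else [::].
Proof.
rewrite (run_rec_step n w erefl) /eval_scal rmorph1 rmorph_sign eval_local.
case: n => [|n] //; congr (_ :: flatten _).
have : {in enum [pred F | facet F T], forall F, facet F T}.
  by move=> F; rewrite mem_enum.
move: (enum [pred F | facet F T]) => s; elim: s => // F Fs IH FsT; rewrite 2!map_cons; congr (_ :: _); last first.
  by apply: IH => F' F's; apply: FsT; rewrite in_cons F's orbT.
by rewrite (facet_degree (FsT F (mem_head _ _))).
Qed.

Lemma run_rec_valid n T (w : dform R (cdim T)) : P r ((cdim T)%:Z - k%:Z) w ->
  forall q, List.In q (run_rec Q n w) ->
    face (projT1 q.2) T /\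
    Pminus (body (projT1 q.2)) r ((cdim (projT1 q.2))%:Z - k%:Z) (projT2 q.2).
Proof.
elim: n T w => [|n IH] T w wr q; rewrite run_recE => -[<- /=|].
- by split; [exact: face_refl|exact: (Pminus_local (@compact_body T) r0 wr)].
- by [].
- by split; [exact: face_refl|exact: (Pminus_local (@compact_body T) r0 wr)].
move=> qin; have [s sin qs] := In_flatten qin.
have [F sE Fin] := In_map sin; move: (In_mem Fin); rewrite mem_enum => FT.
rewrite -sE in qs; have [q' <- q'in] := In_map qs; rewrite /=.
have [q'F q'P] := IH _ _ (P_facet_form FT wr) q' q'in; split=> //.
exact: face_trans (facet_face FT) q'F.
Qed.

Variable tr : forall c : cell M, dform R (cdim c).

(** The part of the definition of the high order space that passes to the faces:
    unlike the space itself, it refers to a fixed family of traces, so that it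
    can be inherited by a face without comparing two choices of traces. *)
Definition element_traces T : Prop := forall c, face c T ->
  [/\ Defs.X (body c) k (@tr c), B (body c) r k (@tr c) &
    forall phi, smooth_form ((cdim c)%:Z - k%:Z - 1) phi ->
      boundary_pairing (body c) k (@tr c) phi =
      \sum_(F | facet F c) incidence F c *
        int_form (body F) (wedge (@tr F) (pullback phi))].

(** The inductive step: the decomposition of [w] as [local_form w] plus the
    derivative of the corrector, then the formula of Stokes. *)
Lemma moment_split T (w : dform R (cdim T)) : element_traces T ->
  P r ((cdim T)%:Z - k%:Z) w ->
  int_form (body T) (wedge (@tr T) w) =
  int_form (body T) (wedge (@tr T) (local_form w)) +
  \sum_(F | facet F T) incidence F T * (-1) ^+ k *
    int_form (body F) (wedge (@tr F) (facet_form F w)).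
Proof.
move=> trT wr; have [[_ trL2 _] trB stokes] := trT T (face_refl T).
have cU := U_corrector (@compact_body T) wr; have [[cr _] _] := cU.
have [lr _] := Pminus_local (@compact_body T) r0 wr.
have dr := P_ext_d cr; rewrite subrK in dr.
have -> : int_form (body T) (wedge (@tr T) w) =
    int_form (body T) (wedge (@tr T) (local_form w)) +
    int_form (body T) (wedge (@tr T) (ext_d (corrector w))).
  rewrite -(int_form_wedgeD (@compact_body T) trL2 lr dr).
  congr (int_form _ (wedge _ _)); apply/funext => x; apply/funext => vs.
  by rewrite mulN1r subrK.
congr (_ + _).
(* In the boundary pairing of the corrector, the term with [du] vanishes. *)
have := stokes _ (P_smooth cr); rewrite /boundary_pairing.
rewrite (int_wedge_weak_d (@compact_body T) trB cU) add0r => E.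
transitivity ((-1) ^+ k * \sum_(F | facet F T) incidence F T *
    int_form (body F) (wedge (@tr F) (pullback (corrector w)))).
  by rewrite -E mulrA -expr2 sqrr_sign mul1r.
rewrite mulr_sumr; apply: eq_bigr => F FT.
have [[_ FL2 _] FB _] := trT F (facet_face FT).
rewrite (int_wedge_L2proj (@compact_body F) FL2 FB (Pminus_facet FT wr)).
by rewrite mulrCA mulrA.
Qed.

Lemma run_rec_moment n T (w : dform R (cdim T)) : (cdim T <= n)%N ->
  element_traces T -> P r ((cdim T)%:Z - k%:Z) w ->
  int_form (body T) (wedge (@tr T) w) =
  \sum_(q <- run_rec Q n w) q.1 *
    int_form (body (projT1 q.2)) (wedge (@tr (projT1 q.2)) (projT2 q.2)).
Proof.
elim: n T w => [|n IH] T w Tn trT wr; rewrite run_recE big_cons /= mul1r.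
  rewrite moment_split// big_nil; congr (_ + _); apply: big_pred0 => F.
  by move: Tn; rewrite leqn0 /facet => /eqP ->; rewrite andbF.
rewrite moment_split// big_flatten /= big_map big_enum /=; congr (_ + _).
apply: eq_big => // F FT; rewrite big_map /=.
rewrite (IH F (facet_form F w)); last exact: P_facet_form.
- by rewrite mulr_sumr; apply: eq_bigr => q _; rewrite mulrA.
- by case/andP: FT => _ /eqP FT; rewrite -ltnS FT.
- by move=> c cF; apply: trT; exact: face_trans (facet_face FT) cF.
Qed.

End Induction.

Theorem proposition3p10 (r k : nat) (hr : (1 <= r)%N) :
  exists Q : nat -> step,
    forall (R : realType) (N : nat) (M : mesh R N) (T : cell M)
      (w : dform R (cdim T)),
    P r ((cdim T)%:Z - k%:Z) w ->
    (forall q, List.In q (run Q w) ->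
       face (projT1 q.2) T /\
       Pminus (body (projT1 q.2)) r ((cdim (projT1 q.2))%:Z - k%:Z)
         (projT2 q.2)) /\
    (forall u : dform R (cdim T), A r k%:Z u ->
       int_form (body T) (wedge u w) =
       \sum_(q <- run Q w) q.1 *
         int_form (body (projT1 q.2))
           (wedge (trace k%:Z u (projT1 q.2)) (projT2 q.2))).
Proof.
exists (moment_step r k) => R N M T w wr; split.
  exact: run_rec_valid wr.
move=> u [_ /getPex trP trB]; have [trT trF] := trP.
have el : element_traces r k (trace k%:Z u) T.
  by move=> c cT; have [Xc stokes] := trF c cT; split=> //; exact: trB.
by have := run_rec_moment hr (leqnn _) el wr; rewrite (trT : trace k%:Z u T = u).
Qed.
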